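(* There is an algorithm which, given $n\ge 1$ and a matrix $A\in\mathbb{T}^{n\times n}$, computes the ultimate rank $\mathrm{urk}(A)$ with time-complexity $O(n^3)$.
   Context: Max-plus semiring: $\mathbb{T}=\mathbb{R}\cup\{-\infty\}$ with ''addition'' $\max$ and ''multiplication'' $+$. Matrix product: $(AB)_{ij}=\max_k(A_{ik}+B_{kj})$; powers are with respect to this product; $(\lambda\odot A)_{ij}=\lambda+A_{ij}$. The null matrix has all entries $-\infty$. Projective classes: matrices $A,B$ are equivalent if $B=\lambda\odot A$ for some $\lambda\in\mathbb{R}$; $\pi$ is the quotient map. Closures of sets of classes: convergence of classes of non-null matrices means convergence of suitably scaled representatives to a non-null matrix (entries may converge to $-\infty$); the class of the null matrix is an isolated point. Ranks: for $B\in\mathbb{T}^{r\times r}$, $\mathrm{per}(B)=\max_{\sigma\in\mathfrak{S}_r}(B_{1\sigma(1)}+\cdots+B_{r\sigma(r)})$; $B$ is singular if $B=(-\infty)\in\mathbb{T}^{1\times1}$ or at least two different permutations attain the maximum, otherwise non-singular. The tropical rank $\mathrm{rk}_{\mathrm{tr}}(A)$ is the maximal $r$ such that $A$ has a non-singular $r\times r$ submatrix ($0$ for a null matrix); it depends only on $\pi(A)$. The ultimate rank is $\mathrm{urk}(A)=\min\{\mathrm{rk}_{\mathrm{tr}}(B): B\in\overline{\{\pi(A^k):k\ge1\}}\}$. Time-complexity counts elementary operations at unit cost: arithmetic operations and comparisons on elements of $\mathbb{T}$, and elementary integer and graph operations. *)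

(* Defs.v *)
From HB Require Import structures.
From mathcomp Require Import all_boot all_order all_fingroup all_algebra.
From mathcomp Require Import all_classical all_reals all_analysis.

Set Implicit Arguments.
Unset Strict Implicit.
Unset Printing Implicit Defensive.

Import Order.TTheory GRing.Theory Num.Theory.

Local Open Scope ring_scope.
Local Open Scope classical_set_scope.
Local Open Scope quotient_scope.

(* [Ninf] is -oo.  With the semiring structure declared below,
   [0 : maxplus R] is -oo, [1 : maxplus R] is the real number 0, [+] is max and
   [*] is the addition of [R]. *)
Variant maxplus (R : realType) : Type := Fin of R | Ninf.

Arguments Ninf {R}.

Definition option_of_maxplus (R : realType) (x : maxplus R) : option R :=
  if x is Fin a then Some a else None.

Definition maxplus_of_option (R : realType) (x : option R) : maxplus R :=
  if x is Some a then Fin a else Ninf.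

Fact option_of_maxplusK (R : realType) :
  cancel (@option_of_maxplus R) (@maxplus_of_option R).
Proof. by case. Qed.

HB.instance Definition _ (R : realType) :=
  Choice.copy (maxplus R) (can_type (@option_of_maxplusK R)).

Section MaxPlusSemiring.
Variable R : realType.
Implicit Types x y z : maxplus R.

Definition maxplus_max x y : maxplus R :=
  match x, y with
  | Fin a, Fin b => Fin (Num.max a b)
  | Fin a, Ninf => Fin a
  | Ninf, _ => y
  end.

Definition maxplus_plus x y : maxplus R :=
  match x, y with
  | Fin a, Fin b => Fin (a + b)
  | _, _ => Ninf
  end.

Definition maxplus_le x y : bool :=
  match x, y with
  | Fin a, Fin b => a <= b
  | Ninf, _ => true
  | Fin _, Ninf => false
  end.

Fact maxplus_maxA : associative maxplus_max.
Proof. by move=> [a|] [b|] [c|] //=; rewrite maxA. Qed.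

Fact maxplus_maxC : commutative maxplus_max.
Proof. by move=> [a|] [b|] //=; rewrite maxC. Qed.

Fact maxplus_max0 : left_id Ninf maxplus_max.
Proof. by []. Qed.

HB.instance Definition _ := GRing.isNmodule.Build (maxplus R)
  maxplus_maxA maxplus_maxC maxplus_max0.

Fact maxplus_plusA : associative maxplus_plus.
Proof. by move=> [a|] [b|] [c|] //=; rewrite addrA. Qed.

Fact maxplus_plusC : commutative maxplus_plus.
Proof. by move=> [a|] [b|] //=; rewrite addrC. Qed.

Fact maxplus_plus1 : left_id (Fin 0) maxplus_plus.
Proof. by move=> [a|] //=; rewrite add0r. Qed.

Fact maxplus_plusDl : left_distributive maxplus_plus maxplus_max.
Proof. by move=> [a|] [b|] [c|] //=; rewrite addr_maxl. Qed.

Fact maxplus_plus0 : left_zero Ninf maxplus_plus.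
Proof. by []. Qed.

Fact maxplus_1neq0 : (Fin 0 : maxplus R) != Ninf.
Proof. by []. Qed.

HB.instance Definition _ := GRing.Nmodule_isComNzSemiRing.Build (maxplus R)
  maxplus_plusA maxplus_plusC maxplus_plus1 maxplus_plusDl maxplus_plus0
  maxplus_1neq0.

(* The topology of the max-plus semiring is that of [-oo, +oo[ in [\bar R]. *)
Definition maxplus_ereal x : \bar R :=
  match x with Fin a => a%:E | Ninf => -oo%E end.

End MaxPlusSemiring.

(* In the semiring [maxplus R], [perm_weight B s] is the sum of the entries
   [B i (s i)], and the permanent is the maximum of these sums. *)
Definition perm_weight (R : realType) (r : nat) (B : 'M[maxplus R]_r)
    (s : 'S_r) : maxplus R :=
  \prod_(i < r) B i (s i).

Definition permanent (R : realType) (r : nat) (B : 'M[maxplus R]_r) :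
    maxplus R :=
  \sum_(s : 'S_r) perm_weight B s.

Definition singular (R : realType) (r : nat) (B : 'M[maxplus R]_r) : bool :=
  ((r == 1%N) && (B == 0)) ||
  (1 < #|[pred s : 'S_r | perm_weight B s == permanent B]|)%N.

Definition increasing_index (r n : nat) (f : {ffun 'I_r -> 'I_n}) : bool :=
  [forall i : 'I_r, forall j : 'I_r, (i < j)%N ==> (f i < f j)%N].

Definition has_nonsingular_submx (R : realType) (n : nat)
    (A : 'M[maxplus R]_n) (r : nat) : bool :=
  [exists f : {ffun 'I_r -> 'I_n}, exists g : {ffun 'I_r -> 'I_n},
    [&& increasing_index f, increasing_index g & ~~ singular (mxsub f g A)]].

Definition tropical_rank (R : realType) (n : nat) (A : 'M[maxplus R]_n) : nat :=
  \max_(r < n.+1 | has_nonsingular_submx A r) r.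

Definition proj_equiv (R : realType) (n : nat) (A B : 'M[maxplus R]_n) : bool :=
  `[< exists l : R, B = Fin l *: A >].

Section ProjectiveSpace.
Variables (R : realType) (n : nat).
Implicit Types A B : 'M[maxplus R]_n.

Fact proj_equiv_refl : reflexive (@proj_equiv R n).
Proof. by move=> A; apply/asboolP; exists 0; rewrite scale1r. Qed.

Fact proj_equiv_sym : symmetric (@proj_equiv R n).
Proof.
suff imp A B : proj_equiv A B -> proj_equiv B A.
  by move=> A B; apply/idP/idP; apply: imp.
move=> /asboolP[l ->]; apply/asboolP; exists (- l).
rewrite scalerA -[A in LHS]scale1r; congr (_ *: _).
by congr Fin; rewrite addNr.
Qed.

Fact proj_equiv_trans : transitive (@proj_equiv R n).
Proof.
move=> B A C /asboolP[l ->] /asboolP[m ->]; apply/asboolP; exists (m + l).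
by rewrite scalerA.
Qed.

Canonical proj_equiv_rel :=
  EquivRel (@proj_equiv R n) proj_equiv_refl proj_equiv_sym proj_equiv_trans.

Definition proj_space := {eq_quot proj_equiv_rel}.

Definition proj_class A : proj_space := \pi_proj_space A.

(* Outside the class of the null matrix, classes converge when representatives
   can be chosen that converge entrywise to a representative of the limit; the
   class of the null matrix is isolated. *)
Definition proj_cvg (c : nat -> proj_space) (l : proj_space) : Prop :=
  if l == proj_class 0 then \forall k \near \oo, c k = proj_class 0
  else exists (M : nat -> 'M[maxplus R]_n) (L : 'M[maxplus R]_n),
    [/\ forall k, proj_class (M k) = c k,
        proj_class L = l
      & forall i j : 'I_n,
          (fun k => maxplus_ereal (M k i j)) @ \oo --> maxplus_ereal (L i j)].

(* The projective space is metrizable, so limits of sequences describe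
   topological closures. *)
Definition proj_closure (S : set proj_space) : set proj_space :=
  [set l | exists c : nat -> proj_space, (forall k, S (c k)) /\ proj_cvg c l].

Fact sub_proj_closure (S : set proj_space) : S `<=` proj_closure S.
Proof.
move=> l Sl; exists (fun=> l); split=> //; rewrite /proj_cvg.
case: eqP => [->|_]; first exact: nearW.
exists (fun=> generic_quotient.repr l), (generic_quotient.repr l).
by split=> [_||i j]; rewrite /proj_class ?reprK //; apply: cvg_cst.
Qed.

Definition power_classes A : set proj_space :=
  [set c | exists2 k : nat, (1 <= k)%N & c = proj_class (A ^+ k)].

Definition ultimate_rank_candidate A (r : nat) : bool :=
  `[< exists B, proj_closure (power_classes A) (proj_class B) /\
                tropical_rank B = r >].

Fact ultimate_rank_candidate_ex A : exists r, ultimate_rank_candidate A r.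
Proof.
exists (tropical_rank (A ^+ 1)); apply/asboolP; exists (A ^+ 1); split=> //.
by apply: sub_proj_closure; exists 1%N.
Qed.

Definition ultimate_rank A : nat := ex_minn (ultimate_rank_candidate_ex A).

End ProjectiveSpace.

(* Programs are finite, contain no real constant other than -oo and 0, and do
   not depend on the size of the input.  Variables and arrays are designated
   by numbers; arrays are indexed by pairs of natural numbers.  Natural numbers
   are only added, subtracted and compared: unit-cost multiplication could
   produce numbers of exponential length. *)

Inductive iexp : Type :=
| IConst of nat
| IVar of nat
| IArr of nat & iexp & iexp
| IAdd of iexp & iexp
| ISub of iexp & iexp.

Inductive texp : Type :=
| TNinfty
| TZero
| TVar of nat
| TArr of nat & iexp & iexp
| TMax of texp & texp
| TAdd of texp & texp
| TSub of texp & texp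
| TDiv of texp & iexp.

Inductive bexp : Type :=
| BLeI of iexp & iexp
| BLeT of texp & texp
| BNot of bexp
| BAnd of bexp & bexp.

Inductive cmd : Type :=
| CSkip
| CSetI of nat & iexp
| CSetT of nat & texp
| CSetIArr of nat & iexp & iexp & iexp
| CSetTArr of nat & iexp & iexp & texp
| CSeq of cmd & cmd
| CIf of bexp & cmd & cmd
| CWhile of bexp & cmd.

Record state (R : realType) : Type := State {
  ivar : nat -> nat;
  iarr : nat -> nat -> nat -> nat;
  tvar : nat -> maxplus R;
  tarr : nat -> nat -> nat -> maxplus R
}.

Section Semantics.
Variable R : realType.
Implicit Types (s : state R) (x y : maxplus R).

(* Tropical division and roots; [x - (-oo)] and the division by the natural
   number 0 take junk values. *)
Definition maxplus_sub x y : maxplus R :=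
  match x, y with
  | Fin a, Fin b => Fin (a - b)
  | _, _ => Ninf
  end.

Definition maxplus_divn x (k : nat) : maxplus R :=
  match x with Fin a => Fin (a / k%:R) | Ninf => Ninf end.

Fixpoint ieval s (e : iexp) : nat :=
  match e with
  | IConst k => k
  | IVar v => ivar s v
  | IArr a e1 e2 => iarr s a (ieval s e1) (ieval s e2)
  | IAdd e1 e2 => (ieval s e1 + ieval s e2)%N
  | ISub e1 e2 => (ieval s e1 - ieval s e2)%N
  end.

Fixpoint teval s (e : texp) : maxplus R :=
  match e with
  | TNinfty => Ninf
  | TZero => Fin 0
  | TVar v => tvar s v
  | TArr a e1 e2 => tarr s a (ieval s e1) (ieval s e2)
  | TMax e1 e2 => maxplus_max (teval s e1) (teval s e2)
  | TAdd e1 e2 => maxplus_plus (teval s e1) (teval s e2)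
  | TSub e1 e2 => maxplus_sub (teval s e1) (teval s e2)
  | TDiv e1 e2 => maxplus_divn (teval s e1) (ieval s e2)
  end.

Fixpoint beval s (b : bexp) : bool :=
  match b with
  | BLeI e1 e2 => (ieval s e1 <= ieval s e2)%N
  | BLeT e1 e2 => maxplus_le (teval s e1) (teval s e2)
  | BNot b1 => ~~ beval s b1
  | BAnd b1 b2 => beval s b1 && beval s b2
  end.

Definition upd1 (T : Type) (f : nat -> T) (a : nat) (v : T) : nat -> T :=
  fun a' => if a' == a then v else f a'.

Definition upd3 (T : Type) (f : nat -> nat -> nat -> T) (a i j : nat) (v : T) :
    nat -> nat -> nat -> T :=
  fun a' i' j' => if [&& a' == a, i' == i & j' == j] then v else f a' i' j'.

Definition set_ivar s (a v : nat) : state R :=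
  State (upd1 (ivar s) a v) (iarr s) (tvar s) (tarr s).

Definition set_iarr s (a i j v : nat) : state R :=
  State (ivar s) (upd3 (iarr s) a i j v) (tvar s) (tarr s).

Definition set_tvar s (a : nat) (x : maxplus R) : state R :=
  State (ivar s) (iarr s) (upd1 (tvar s) a x) (tarr s).

Definition set_tarr s (a i j : nat) (x : maxplus R) : state R :=
  State (ivar s) (iarr s) (tvar s) (upd3 (tarr s) a i j x).

End Semantics.

Fixpoint icost (e : iexp) : nat :=
  match e with
  | IConst _ | IVar _ => 1
  | IArr _ e1 e2 | IAdd e1 e2 | ISub e1 e2 => (icost e1 + icost e2).+1
  end.

Fixpoint tcost (e : texp) : nat :=
  match e with
  | TNinfty | TZero | TVar _ => 1
  | TArr _ e1 e2 => (icost e1 + icost e2).+1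
  | TMax e1 e2 | TAdd e1 e2 | TSub e1 e2 => (tcost e1 + tcost e2).+1
  | TDiv e1 e2 => (tcost e1 + icost e2).+1
  end.

Fixpoint bcost (b : bexp) : nat :=
  match b with
  | BLeI e1 e2 => (icost e1 + icost e2).+1
  | BLeT e1 e2 => (tcost e1 + tcost e2).+1
  | BNot b1 => (bcost b1).+1
  | BAnd b1 b2 => (bcost b1 + bcost b2).+1
  end.

(* [exec c s s' t]: started in state [s], [c] halts in state [s'] after [t]
   elementary operations. *)
Inductive exec (R : realType) : cmd -> state R -> state R -> nat -> Prop :=
| ExecSkip s :
    exec CSkip s s 1
| ExecSetI s v e :
    exec (CSetI v e) s (set_ivar s v (ieval s e)) (icost e).+1
| ExecSetT s v e :
    exec (CSetT v e) s (set_tvar s v (teval s e)) (tcost e).+1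
| ExecSetIArr s a e1 e2 e :
    exec (CSetIArr a e1 e2 e) s
         (set_iarr s a (ieval s e1) (ieval s e2) (ieval s e))
         (icost e1 + icost e2 + icost e).+1
| ExecSetTArr s a e1 e2 e :
    exec (CSetTArr a e1 e2 e) s
         (set_tarr s a (ieval s e1) (ieval s e2) (teval s e))
         (icost e1 + icost e2 + tcost e).+1
| ExecSeq c1 c2 s s1 s2 t1 t2 :
    exec c1 s s1 t1 -> exec c2 s1 s2 t2 ->
    exec (CSeq c1 c2) s s2 (t1 + t2)%N
| ExecIfTrue b c1 c2 s s1 t :
    beval s b -> exec c1 s s1 t ->
    exec (CIf b c1 c2) s s1 (bcost b + t).+1
| ExecIfFalse b c1 c2 s s1 t :
    ~~ beval s b -> exec c2 s s1 t ->
    exec (CIf b c1 c2) s s1 (bcost b + t).+1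
| ExecWhileStop b c s :
    ~~ beval s b ->
    exec (CWhile b c) s s (bcost b).+1
| ExecWhileStep b c s s1 s2 t1 t2 :
    beval s b -> exec c s s1 t1 -> exec (CWhile b c) s1 s2 t2 ->
    exec (CWhile b c) s s2 (bcost b + t1 + t2).+1.

(* The input [n] is stored in the integer variable 0 and [A] in the array 0 of
   max-plus numbers; all other memory cells contain 0 or -oo. *)
Definition input_state (R : realType) (n : nat) (A : 'M[maxplus R]_n) :
    state R :=
  State (fun v => if v == 0%N then n else 0%N)
        (fun _ _ _ => 0%N)
        (fun _ => Ninf)
        (fun a i j =>
           match a, insub i : option 'I_n, insub j : option 'I_n with
           | 0%N, Some i', Some j' => A i' j'
           | _, _, _ => Ninf
           end).

Definition output (R : realType) (s : state R) : nat := ivar s 0.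

(* Main.v *)
Require Import Defs.
From mathcomp Require Import all_boot all_order all_fingroup all_algebra.
From mathcomp Require Import all_classical all_reals all_analysis.
From mathcomp Require Import ring lra zify.

(** After removing the maximal cycle mean [l] and conjugating by potentials
    [p], all entries of the matrix become nonpositive: [A u v] equals
    [l - p u + p v] plus the entry [B u v] of a matrix [B <= 0].  The critical
    graph is made of the zero entries of [B] that lie on cycles of zero
    entries.  Each of its strongly connected components splits into cyclic
    classes, the arcs leading from one class to the next, and the ultimate rank
    is the total number of classes (0 if there is no cycle at all, because then
    the powers of the matrix vanish).

    Lower bound ([limit_rank_ge], [label_columns]).  Take one node [a] in each
    class as a row, and as a column a node reached from [a] by [k] critical
    steps.  This submatrix of the [k]-th power of [B] has a zero diagonal and no
    positive entry.  A permutation formed of zeros would put the nodes [a] of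
    each of its cycles into one component, and there the number of steps
    determines the class that is reached, so it is the identity.  Moreover
    nonzero entries of powers of [B] stay away from 0 ([zero_walk_gap]), hence
    the submatrix remains nonsingular in every projective limit.

    Upper bound ([pow_cvg], [ultimate_rank_le]).  Let all critical nodes lie on
    closed walks of weight 0 of one length [N], and let [C] be the [N]-th power
    of [B].  Walks that avoid the critical nodes have weights that tend to -oo,
    and the others can be prolonged for free at a critical node; hence the
    powers of [C] converge to the maximum over critical nodes [r] of
    [U u r + V r v].  This depends on [r] only through its class, so the limit
    factors through as many indices as there are classes, which bounds its
    tropical rank ([singular_factor]).

    Computation of [l] and [p].  Let [D k v] be the maximal weight of a walk of
    length [k] ending in [v], computed for [k <= n].  Karp's formula gives
    [l = max_v min_(k < n) (D n v - D k v) / (n - k)], and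
    [p v = max_(k < n) (D k v - k * l)].  The formula for [l] says that length
    [n] does not improve on [p], so that [p] is a potential ([potential_arc]);
    for a node [v] where the maximum is attained, an optimal walk of length [n]
    ending in [v] consists of zero entries of [B] only ([tight_walk]), and it
    has to contain a cycle.

    Computation of the classes.  The transitive closure of the zero graph gives
    the critical arcs.  The classes are the finest equivalence for which the
    successors of equivalent critical nodes are equivalent.  They are found by
    fixing one critical successor [S u] of each critical node and merging,
    while there is a critical arc from [u] to [v] such that the labels of [v]
    and of [S] at the label of [u] differ, these two labels.  At most [n] passes
    of cost [O(n ^ 2)] are needed ([merge_labels_spec]).  The lower bound uses
    only that the labels are compatible with successors, and the upper bound
    only that merged nodes belong to the same class, so that the period of a
    component is never computed. *)

Set Implicit Arguments.
Unset Strict Implicit.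
Unset Printing Implicit Defensive.

Import Order.TTheory GRing.Theory Num.Theory.

Local Open Scope ring_scope.

(** * The order of the max-plus semiring *)

Local Notation "x <=t y" := (maxplus_le x y) (at level 70, no associativity).

Section MaxPlusOrder.
Variable R : realType.
Implicit Types x y z t : maxplus R.

Lemma mple_refl x : x <=t x.
Proof. by case: x => //= a. Qed.

Lemma mple_trans y x z : x <=t y -> y <=t z -> x <=t z.
Proof. by case: x y z => [a|] [b|] [c|] //=; apply: le_trans. Qed.

Lemma mple_anti x y : x <=t y -> y <=t x -> x = y.
Proof.
by case: x y => [a|] [b|] //= ab ba; congr Fin; apply/le_anti; rewrite ab ba.
Qed.

Lemma mple_total x y : (x <=t y) || (y <=t x).
Proof. by case: x y => [a|] [b|] //=; apply: le_total. Qed.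

Lemma mp0le x : 0 <=t x.
Proof. by []. Qed.

Lemma mple0 x : x <=t 0 -> x = 0.
Proof. by case: x. Qed.

Lemma mp_add_left x y : x <=t x + y.
Proof. by case: x y => [a|] [b|] //=; rewrite ?lexx // le_max lexx. Qed.

Lemma mp_add_right x y : y <=t x + y.
Proof. by rewrite addrC mp_add_left. Qed.

Lemma mp_add_lub x y z : x <=t z -> y <=t z -> x + y <=t z.
Proof. by case: x y z => [a|] [b|] [c|] //=; rewrite ge_max => -> ->. Qed.

Lemma mp_add_cases x y : x + y = x \/ x + y = y.
Proof.
case: x y => [a|] [b|]; try by [left|right].
rewrite /GRing.add /= /Num.max; case: ifP => _; by [right|left].
Qed.

Lemma mple_add x y z t : x <=t y -> z <=t t -> x + z <=t y + t.
Proof.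
move=> xy zt; apply: mp_add_lub.
  exact: mple_trans xy (mp_add_left _ _).
exact: mple_trans zt (mp_add_right _ _).
Qed.

Lemma mple_mul x y z t : x <=t y -> z <=t t -> x * z <=t y * t.
Proof. by case: x y z t => [a|] [b|] [c|] [d|] //=; apply: lerD. Qed.

Lemma mple_mull x y z : y <=t z -> x * y <=t x * z.
Proof. by move=> yz; apply: mple_mul => //; apply: mple_refl. Qed.

Lemma mple_mulr x y z : y <=t z -> y * x <=t z * x.
Proof. by move=> yz; apply: mple_mul => //; apply: mple_refl. Qed.

Lemma mp_mul_le1 x y : x <=t 1 -> y <=t 1 -> x * y <=t 1.
Proof. by move=> x1 y1; rewrite -[1]mulr1; apply: mple_mul. Qed.

Lemma mp_mul_eq1 x y : x <=t 1 -> y <=t 1 -> x * y = 1 -> x = 1 /\ y = 1.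
Proof.
case: x y => [a|] [b|] //= a0 b0 [] ab0.
by split; congr Fin; lra.
Qed.

Lemma mp_mul_le_left x y : y <=t 1 -> x * y <=t x.
Proof. by move=> y1; rewrite -[X in _ <=t X]mulr1; apply: mple_mull. Qed.

Lemma mp_mul_le_right x y : x <=t 1 -> x * y <=t y.
Proof. by rewrite mulrC; apply: mp_mul_le_left. Qed.

Lemma mp_sum_le (I : Type) (r : seq I) (P : pred I) (F : I -> maxplus R) y :
  (forall i, P i -> F i <=t y) -> \sum_(i <- r | P i) F i <=t y.
Proof.
move=> le_y; elim/big_rec: _ => [|i x Pi xy]; first exact: mp0le.
by apply: mp_add_lub => //; apply: le_y.
Qed.

Lemma mp_le_sum (I : eqType) (r : seq I) (P : pred I) (F : I -> maxplus R) i :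
  i \in r -> P i -> F i <=t \sum_(i <- r | P i) F i.
Proof.
elim: r => //= j r IH; rewrite inE big_cons => /orP[/eqP<- ->|ir Pi].
  exact: mp_add_left.
case: ifP => _; last exact: IH.
exact: mple_trans (IH ir Pi) (mp_add_right _ _).
Qed.

Lemma mp_le_sumT (I : finType) (P : pred I) (F : I -> maxplus R) i :
  P i -> F i <=t \sum_(i | P i) F i.
Proof. by apply: mp_le_sum; rewrite mem_index_enum. Qed.

Lemma mp_sum_attained (I : eqType) (r : seq I) (P : pred I)
    (F : I -> maxplus R) :
  \sum_(i <- r | P i) F i = 0 \/
  exists i, [/\ i \in r, P i & \sum_(i <- r | P i) F i = F i].
Proof.
elim: r => [|j r IH]; first by left; rewrite big_nil.
rewrite big_cons; case: ifP => Pj; last first.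
  case: IH => [->|[i [ir Pi ->]]]; [by left|right].
  by exists i; rewrite inE ir orbT.
have [->|->] := mp_add_cases (F j) (\sum_(i <- r | P i) F i).
  by right; exists j; rewrite mem_head.
case: IH => [->|[i [ir Pi ->]]]; [by left|right].
by exists i; rewrite inE ir orbT.
Qed.

Lemma mp_prod_le1 (I : Type) (r : seq I) (P : pred I) (F : I -> maxplus R) :
  (forall i, P i -> F i <=t 1) -> \prod_(i <- r | P i) F i <=t 1.
Proof.
move=> F1; elim/big_rec: _ => [|i x Pi x1]; first exact: mple_refl.
by apply: mp_mul_le1 => //; apply: F1.
Qed.

Lemma mp_prod_eq1 (I : finType) (F : I -> maxplus R) :
  (forall i, F i <=t 1) -> \prod_i F i = 1 -> forall i, F i = 1.
Proof.
move=> F1 prod1 i; move: prod1; rewrite (bigD1 i) //= => prod1.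
by case: (mp_mul_eq1 (F1 i) (mp_prod_le1 _ _) prod1).
Qed.

Lemma mp_FinM (a b : R) : Fin a * Fin b = Fin (a + b).
Proof. by []. Qed.

Lemma mp_FinVK (a : R) x : Fin (- a) * (Fin a * x) = x.
Proof. by rewrite mulrA mp_FinM addNr (_ : Fin 0 = 1) ?mul1r. Qed.

Lemma mp_FinKV (a : R) x : Fin a * (Fin (- a) * x) = x.
Proof. by rewrite mulrA mp_FinM addrN (_ : Fin 0 = 1) ?mul1r. Qed.

End MaxPlusOrder.

Arguments maxplus_le : simpl never.

(** * Powers as maximal weights of walks *)

Section Powers.
Variables (R : realType) (n : nat).
Implicit Types (B : 'M[maxplus R]_n) (u v w : 'I_n) (p q : seq 'I_n).

Lemma mx_powS B k u v : (B ^+ k.+1) u v = \sum_w B u w * (B ^+ k) w v.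
Proof. by rewrite exprS !mxE. Qed.

Lemma mx_pow0 B u v : (B ^+ 0) u v = (u == v)%:R.
Proof. by rewrite expr0 !mxE. Qed.

Lemma mx_pow_le B k l u w v :
  (B ^+ k) u w * (B ^+ l) w v <=t (B ^+ (k + l)) u v.
Proof. by rewrite exprD !mxE; apply: (mp_le_sumT (P := xpredT)). Qed.

Lemma mx_powD B k l u v :
  (B ^+ (k + l)) u v = 0 \/
  exists w, (B ^+ (k + l)) u v = (B ^+ k) u w * (B ^+ l) w v.
Proof.
rewrite exprD mxE; case: (mp_sum_attained (index_enum 'I_n) xpredT
  (fun w => (B ^+ k) u w * (B ^+ l) w v)) => [->|[w [_ _ ->]]]; [by left|right].
by exists w.
Qed.

Fixpoint path_weight B u p : maxplus R :=
  if p is w :: q then B u w * path_weight B w q else 1.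

Lemma path_weight_cat B u p q :
  path_weight B u (p ++ q) = path_weight B u p * path_weight B (last u p) q.
Proof. by elim: p u => [|w p IH] u /=; rewrite ?mul1r // IH mulrA. Qed.

Lemma path_weight_le B u p : path_weight B u p <=t (B ^+ size p) u (last u p).
Proof.
elim: p u => [|w p IH] u /=; first by rewrite mx_pow0 eqxx mple_refl.
rewrite mx_powS; apply: mple_trans (mple_mull _ (IH w)) _.
exact: (mp_le_sumT (P := xpredT) (fun w => B u w * (B ^+ size p) w _)).
Qed.

Lemma mx_pow_path B k u v :
  (B ^+ k) u v = 0 \/
  exists p, [/\ size p = k, last u p = v & (B ^+ k) u v = path_weight B u p].
Proof.
elim: k u => [|k IH] u.
  rewrite mx_pow0; case: eqP => [->|_]; last by left.
  by right; exists [::].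
rewrite mx_powS; case: (mp_sum_attained (index_enum 'I_n) xpredT
  (fun w => B u w * (B ^+ k) w v)) => [->|[w [_ _ ->]]]; first by left.
case: (IH w) => [->|[p [sz lst ->]]]; first by left; rewrite mulr0.
by right; exists (w :: p); rewrite /= sz lst.
Qed.

(** Pigeonhole: an optimal walk of length at least [n] passes twice through
    some node [w], hence contains a closed walk at [w]. *)
Lemma mx_pow_cycle B k u v : (n <= k)%N ->
  exists w a b c, [/\ (0 < b)%N, (a + b + c)%N = k &
    (B ^+ k) u v <=t (B ^+ a) u w * (B ^+ b) w w * (B ^+ c) w v].
Proof.
move=> nk; have k_gt0 : (0 < k)%N by apply: leq_trans nk; case: n u => [[]|].
case: (mx_pow_path B k u v) => [->|[p [sz lst ->]]].
  by exists u, 0%N, k, 0%N; rewrite add0n addn0.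
have : ~~ uniq (u :: p).
  apply/negP => /card_uniqP /= E; have := max_card (mem (u :: p)).
  by rewrite E card_ord sz ltnNge nk.
move=> /(uniqPn u)[i [j [ij]]]; rewrite /= sz ltnS => jk.
have nthE h : (h <= k)%N -> nth u (u :: p) h = last u (take h p).
  case: h => [|h] hk; first by rewrite take0.
  by rewrite -[RHS]nth_last size_takel ?sz //= nth_take.
have ik : (i <= k)%N by apply: leq_trans jk; apply: ltnW.
rewrite !nthE // => eq_ij.
pose w := last u (take i p).
have pE : p = take i p ++ drop i (take j p) ++ drop j p.
  by rewrite catA -{1}(take_takel p (ltnW ij)) cat_take_drop cat_take_drop.
have lastw : last w (drop i (take j p)) = w.
  rewrite {2}/w eq_ij /w -{2}[take j p](cat_take_drop i) last_cat take_takel //.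
  exact: ltnW.
exists w, i, (j - i)%N, (k - j)%N; split.
- by rewrite subn_gt0.
- by rewrite subnKC ?(ltnW ij) // subnKC.
- rewrite {1}pE !path_weight_cat mulrA -/w lastw.
  have sz1 : size (take i p) = i by rewrite size_takel // sz.
  have sz2 : size (drop i (take j p)) = (j - i)%N.
    by rewrite size_drop size_takel // sz.
  have sz3 : size (drop j p) = (k - j)%N by rewrite size_drop sz.
  apply: mple_mul; first apply: mple_mul.
  + by have := path_weight_le B u (take i p); rewrite sz1.
  + by have := path_weight_le B w (drop i (take j p)); rewrite sz2 lastw.
  + have := path_weight_le B w (drop j p); rewrite sz3.
    suff -> : last w (drop j p) = v by [].
    by rewrite -lst [in RHS]pE !last_cat -/w lastw.
Qed.

End Powers.

(** * Tropical rank *)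

Lemma mp_prod_mono (R : realType) (I : Type) (r : seq I) (P : pred I)
    (F G : I -> maxplus R) :
  (forall i, P i -> F i <=t G i) ->
  \prod_(i <- r | P i) F i <=t \prod_(i <- r | P i) G i.
Proof.
move=> FG; elim/big_rec2: _ => [|i y x Pi xy]; first exact: mple_refl.
by apply: mple_mul => //; apply: FG.
Qed.

Section TropicalRank.
Variable R : realType.

Lemma permanent_attained r (M : 'M[maxplus R]_r) :
  exists s, permanent M = perm_weight M s.
Proof.
case: (mp_sum_attained (index_enum 'S_r) xpredT (perm_weight M)) => E.
  exists 1%g; rewrite /permanent E; apply/esym/mple0; rewrite -E.
  exact: (mp_le_sumT (P := xpredT)).
by case: E => s [_ _ E]; exists s.
Qed.

Lemma perm_weight_le r (M : 'M[maxplus R]_r) s :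
  perm_weight M s <=t permanent M.
Proof. exact: (mp_le_sumT (P := xpredT)). Qed.

(** For [r = 1] there is a single permutation, and the clause that excludes
    the weight -oo is the convention on the null matrix of size 1; for larger
    [r] that clause follows from strict maximality. *)
Lemma nonsingularP r (M : 'M[maxplus R]_r) :
  reflect (exists s, perm_weight M s <> 0 /\
             forall t, t != s -> ~~ (perm_weight M s <=t perm_weight M t))
          (~~ singular M).
Proof.
apply: (iffP idP) => [|[s [s0 smax]]].
  rewrite negb_or -leqNgt => /andP[M1 card1].
  have [s sE] := permanent_attained M; exists s; split.
    move=> s0; have all0 t : perm_weight M t = 0.
      by apply: mple0; rewrite -s0 -sE perm_weight_le.
    move: card1; rewrite (eq_card (B := predT)); last first.
      by move=> t; rewrite !inE all0 sE s0 eqxx.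
    rewrite cardT -cardE card_Sn.
    case: r M M1 s s0 {sE all0} => [|[|r]] M M1 s s0.
    - by move: s0; rewrite /perm_weight big_ord0.
    - move=> _; move: M1; rewrite /= => /eqP; apply; apply/matrixP => i j.
      move: s0; rewrite /perm_weight big_ord1 !ord1 mxE; exact.
    - by move=> card1; have := leq_trans (fact_geq r.+2) card1.
  move=> t ts; apply/negP => le_st; move: card1; rewrite leqNgt => /negP; apply.
  apply/card_gt1P; exists s, t; split; rewrite ?inE ?sE ?eqxx 1?eq_sym //.
  by apply/eqP/mple_anti => //; rewrite -sE perm_weight_le.
have sE : permanent M = perm_weight M s.
  have [t tE] := permanent_attained M.
  have [<- //|ts] := eqVneq t s.
  by case/negP: (smax _ ts); rewrite -tE perm_weight_le.
rewrite negb_or; apply/andP; split.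
  apply/negP => /andP[/eqP r1 /eqP M0]; case: s0.
  by subst r; rewrite /perm_weight big_ord1 M0 mxE.
apply/negP => /card_gt1P[t [t' [/eqP tE /eqP t'E tt']]].
have le_s t0 : perm_weight M t0 = permanent M -> t0 = s.
  move=> E; have [//|ts] := eqVneq t0 s.
  by case/negP: (smax _ ts); rewrite E sE mple_refl.
by case/eqP: tt'; rewrite (le_s t) // (le_s t').
Qed.

Lemma nonsingular_mxsub_perm r (M : 'M[maxplus R]_r) (p q : 'S_r) :
  ~~ singular (mxsub p q M) -> ~~ singular M.
Proof.
have pwE s : perm_weight (mxsub p q M) s = perm_weight M (p^-1 * s * q)%g.
  rewrite /perm_weight [RHS](reindex_inj (@perm_inj _ p)) /=.
  by apply: eq_bigr => i _; rewrite mxE !permM permK.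
move=> /nonsingularP[s [s0 smax]]; apply/nonsingularP.
exists (p^-1 * s * q)%g; rewrite -pwE; split=> // t ts.
have tE : t = (p^-1 * (p * t * q^-1) * q)%g by rewrite !mulgA mulVg mul1g mulgKV.
rewrite tE -pwE; apply: smax; apply: contra ts => /eqP <-.
by rewrite -tE.
Qed.

(** Every permutation gains the same weight, the sum of all the factors. *)
Lemma nonsingular_scale r (M M' : 'M[maxplus R]_r) (x y : 'I_r -> R) :
  (forall i j, M' i j = Fin (x i) * M i j * Fin (y j)) ->
  ~~ singular M -> ~~ singular M'.
Proof.
move=> M'E.
pose X : R := \sum_i x i + \sum_i y i.
have prodFin (z : 'I_r -> R) : \prod_i Fin (z i) = Fin (\sum_i z i).
  by elim/big_rec2: _ => // i a b _ ->.
have pwE s : perm_weight M' s = Fin X * perm_weight M s.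
  rewrite /perm_weight (eq_bigr _ (fun i _ => M'E i (s i))) !big_split /=.
  have -> : \prod_i Fin (y (s i)) = \prod_i Fin (y i).
    by rewrite [RHS](reindex_inj (@perm_inj _ s)).
  by rewrite !prodFin mulrAC.
move=> /nonsingularP[s [s0 smax]]; apply/nonsingularP; exists s; split.
  by rewrite pwE => E; apply: s0; rewrite -(mp_FinVK X (perm_weight M s)) E.
move=> t /smax; apply: contra; rewrite !pwE => le_st.
by rewrite -(mp_FinVK X (perm_weight M s)) -(mp_FinVK X (perm_weight M t))
  mple_mull.
Qed.

(** The increasing enumeration of the image of [f] differs from [f] by a
    permutation. *)
Lemma increasing_reindex r n (f : 'I_r -> 'I_n) : injective f ->
  exists (f' : {ffun 'I_r -> 'I_n}) (p : 'S_r),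
    increasing_index f' /\ forall i, f i = f' (p i).
Proof.
move=> f_inj; pose S := [set f i | i in 'I_r].
have cardS : #|S| = r by rewrite card_imset // card_ord.
have fS i : f i \in S by apply: imset_f.
pose f' : {ffun 'I_r -> 'I_n} := [ffun i => enum_val (cast_ord (esym cardS) i)].
pose p i := cast_ord cardS (enum_rank_in (fS i) (f i)).
have fE i : f i = f' (p i).
  by rewrite ffunE /p cast_ordK enum_rankK_in.
have p_inj : injective p by move=> i j pij; apply: f_inj; rewrite !fE pij.
exists f', (perm p_inj); split; last by move=> i; rewrite permE.
have sortedS : sorted ltn (map val (enum S)).
  rewrite {1}/enum_mem -enumT sorted_map.
  apply: (@sorted_filter _ (relpre val ltn)).
    by move=> ? ? ?; apply: ltn_trans.
  by rewrite -sorted_map val_enum_ord iota_ltn_sorted.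
apply/forallP => i; apply/forallP => j; apply/implyP => ij; rewrite !ffunE.
set i' := cast_ord _ i; set j' := cast_ord _ j.
have x0 := enum_val i'.
rewrite !(enum_val_nth x0) -!(nth_map x0 (val x0)) -?cardE ?ltn_ord //.
apply: (sorted_ltn_nth ltn_trans) => //; by rewrite inE size_map -cardE.
Qed.

(** Submatrices are given by increasing choices of rows and columns; the order
    does not matter, since permuting them only permutes the weights. *)
Lemma has_nonsingular_submx_inj n (A : 'M[maxplus R]_n) r
    (f g : 'I_r -> 'I_n) :
  injective f -> injective g -> ~~ singular (mxsub f g A) ->
  has_nonsingular_submx A r.
Proof.
move=> /increasing_reindex[f' [p [incf fE]]].
move=> /increasing_reindex[g' [q [incg gE]]] nonsing.
apply/existsP; exists f'; apply/existsP; exists g'; rewrite incf incg /=.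
apply: (nonsingular_mxsub_perm (p := p) (q := q)).
congr (~~ singular _): nonsing; apply/matrixP => i j.
by rewrite !mxE fE gE.
Qed.

Lemma tropical_rank_ge n (A : 'M[maxplus R]_n) r :
  has_nonsingular_submx A r -> (r <= tropical_rank A)%N.
Proof.
move=> Ar; have rn : (r < n.+1)%N.
  case/existsP: Ar => f /existsP[g /and3P[/forallP incf _ _]].
  have f_inj : injective f.
    move=> i j fij; case: (ltngtP i j) => [ij|ji|/val_inj //].
      by have /forallP/(_ j)/implyP/(_ ij) := incf i; rewrite fij ltnn.
    by have /forallP/(_ i)/implyP/(_ ji) := incf j; rewrite fij ltnn.
  by rewrite ltnS; have := leq_card f f_inj; rewrite !card_ord.
exact: (leq_bigmax_cond (F := fun i : 'I_n.+1 => val i) (Ordinal rn) Ar).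
Qed.

(** In a product through fewer than [r] indices, two of the [r] entries picked
    by an optimal permutation use the same intermediate index; exchanging their
    columns gives another permutation of the same weight. *)
Lemma singular_factor r (K : finType) (F : {set K}) (M : 'M[maxplus R]_r)
    (U : 'I_r -> K -> maxplus R) (V : K -> 'I_r -> maxplus R) :
  (forall i j, M i j = \sum_(k in F) U i k * V k j) -> (#|F| < r)%N ->
  singular M.
Proof.
move=> ME Fr; apply/negPn/negP => /nonsingularP[s [s0 smax]].
have kP i : exists k, k \in F /\ M i (s i) = U i k * V k (s i).
  have := mp_sum_attained (index_enum K) (mem F) (fun k => U i k * V k (s i)).
  rewrite -ME => -[M0|[k [_ kF kE]]]; last by exists k.
  by case: s0; rewrite /perm_weight (bigD1 i) //= M0 mul0r.
have [k /all_and2[kF kE]] := choice kP.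
have /injectivePn[i [j ij kij]] : ~~ injectiveb k.
  apply/negP => /injectiveP k_inj; move: Fr; rewrite ltnNge => /negP; apply.
  rewrite -[r]card_ord -(card_codom k_inj); apply/subset_leq_card/fintype.subsetP.
  by move=> _ /codomP[i ->].
pose t := (tperm i j * s)%g.
have ts : t != s.
  apply/eqP => /permP/(_ i); rewrite permM tpermL => /perm_inj E.
  by rewrite E eqxx in ij.
case/negP: (smax t ts); rewrite /perm_weight (eq_bigr _ (fun i _ => kE i)).
rewrite big_split /= [X in _ * X](reindex_inj (@perm_inj _ (tperm i j))) /=.
rewrite -big_split /=; apply: mp_prod_mono => x _.
have -> : k (tperm i j x) = k x by case: tpermP => // ->.
by rewrite permM ME; apply: (mp_le_sumT (fun k => U x k * V k _)); apply: kF.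
Qed.

Lemma tropical_rank_factor n (K : finType) (F : {set K}) (A : 'M[maxplus R]_n)
    (U : 'I_n -> K -> maxplus R) (V : K -> 'I_n -> maxplus R) :
  (forall i j, A i j = \sum_(k in F) U i k * V k j) ->
  (tropical_rank A <= #|F|)%N.
Proof.
move=> AE; apply/bigmax_leqP => r /existsP[f /existsP[g /and3P[_ _]]].
apply: contraNT; rewrite -ltnNge => Fr.
apply: (@singular_factor _ K F _ (fun i => U (f i)) (fun k j => V k (g j))) => //.
by move=> i j; rewrite mxE AE.
Qed.

End TropicalRank.

(** * Walks of weight 0 *)

Section ZeroWalks.
Variables (R : realType) (n : nat) (B : 'M[maxplus R]_n).
Hypothesis B_le1 : forall u v, B u v <=t 1.
Implicit Types u v w : 'I_n.

(** No walk has positive weight, so an entry 0 of a power comes from a walk all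
    of whose arcs have weight 0. *)
Definition zero_walk k u v : Prop := (B ^+ k) u v = 1.

Lemma pow_le1 k u v : (B ^+ k) u v <=t 1.
Proof.
elim: k u => [|k IH] u.
  by rewrite mx_pow0; case: (u == v); [apply: mple_refl|apply: mp0le].
by rewrite mx_powS; apply: mp_sum_le => w _; apply: mp_mul_le1.
Qed.

Lemma zero_walk0 u : zero_walk 0 u u.
Proof. by rewrite /zero_walk mx_pow0 eqxx. Qed.

Lemma zero_walk0_eq u v : zero_walk 0 u v -> u = v.
Proof.
by rewrite /zero_walk mx_pow0; case: eqP => // _ /eqP.
Qed.

Lemma zero_walk1 u v : zero_walk 1 u v <-> B u v = 1.
Proof. by rewrite /zero_walk expr1. Qed.

Lemma zero_walk_cat k l u w v :
  zero_walk k u w -> zero_walk l w v -> zero_walk (k + l) u v.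
Proof.
rewrite /zero_walk => uw wv; apply: mple_anti; first exact: pow_le1.
by have := mx_pow_le B k l u w v; rewrite uw wv mulr1.
Qed.

Lemma zero_walk_split k l u v :
  zero_walk (k + l) u v -> exists w, zero_walk k u w /\ zero_walk l w v.
Proof.
rewrite /zero_walk; case: (mx_powD B k l u v) => [->|[w ->]] // uv.
by exists w; apply: mp_mul_eq1 uv; apply: pow_le1.
Qed.

Lemma zero_walk_loop b k u : zero_walk b u u -> zero_walk (k * b) u u.
Proof.
move=> uu; elim: k => [|k IH]; first exact: zero_walk0.
by rewrite mulSn; apply: zero_walk_cat uu IH.
Qed.

Lemma zero_walk_cycle k u v : (n <= k)%N -> zero_walk k u v ->
  exists w b, (0 < b)%N /\ zero_walk b w w.
Proof.
move=> nk uv; have [w [a [b [c [b0 _ le_uv]]]]] := mx_pow_cycle B u v nk.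
exists w, b; split=> //; apply: mple_anti; first exact: pow_le1.
move: le_uv; rewrite uv => /mple_trans; apply.
apply: mple_trans (mp_mul_le_left _ (pow_le1 _ _ _)) _.
exact: mp_mul_le_right (pow_le1 _ _ _).
Qed.

(** There are finitely many entries, so the nonzero ones stay away from 0, and
    so does every product in which one of them occurs. *)
Lemma zero_walk_gap :
  exists2 d : R, 0 < d & forall k u v,
    zero_walk k u v \/ (B ^+ k) u v <=t Fin (- d).
Proof.
pose D (z : 'I_n * 'I_n) : R := if B z.1 z.2 is Fin a then - a else 1.
pose d := \big[Num.min/1]_(z | B z.1 z.2 != 1) D z.
have d_gt0 : 0 < d.
  apply/bigmin_gtP; split=> // -[u v] /= Buv; rewrite /D /=.
  case E: (B u v) => [a|] //; move: (B_le1 u v) Buv; rewrite E => a0 a1.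
  rewrite oppr_gt0 lt_neqAle; apply/andP; split=> //.
exists d => // k u v; elim: k u => [|k IH] u.
  by rewrite /zero_walk mx_pow0; case: eqP => _; [left|right; apply: mp0le].
have B_gap w : B u w = 1 \/ B u w <=t Fin (- d).
  case: (eqVneq (B u w) 1) => [->|Buw]; [by left|right].
  have : d <= D (u, w) by apply: bigmin_le_cond.
  by rewrite /D /=; case: (B u w) => [a|] // H; rewrite /maxplus_le lerNr.
rewrite /zero_walk mx_powS.
have := mp_sum_attained (index_enum 'I_n) xpredT
  (fun w => B u w * (B ^+ k) w v).
case=> [->|[w [_ _ ->]]]; first by right; apply: mp0le.
case: (B_gap w) => [->|le_uw].
  by rewrite mul1r; apply: IH.
right; apply: mple_trans le_uw; exact: mp_mul_le_left (pow_le1 _ _ _).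
Qed.

End ZeroWalks.

(** The potentials of the intermediate nodes cancel along a walk. *)
Lemma pow_scaled (R : realType) n (A B : 'M[maxplus R]_n) (l : R)
    (p : 'I_n -> R) :
  (forall u v, A u v = Fin (l - p u + p v) * B u v) ->
  forall k u v, (A ^+ k) u v = Fin (k%:R * l - p u + p v) * (B ^+ k) u v.
Proof.
move=> AE; elim=> [|k IH] u v.
  rewrite !mx_pow0; case: eqP => [->|_]; last by rewrite !mulr0.
  rewrite (_ : Fin _ = 1) ?mul1r //; congr Fin; ring.
rewrite !mx_powS mulr_sumr; apply: eq_bigr => w _.
rewrite AE IH mulrACA mp_FinM; congr (_ * _); congr Fin.
by rewrite -natr1; ring.
Qed.

(** * Limits in the projective space *)

Section Limits.
Local Open Scope classical_set_scope.
Variable R : realType.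
Implicit Types (x y : nat -> maxplus R) (a b : maxplus R).

Definition mp_cvg x a : Prop :=
  (fun k => maxplus_ereal (x k)) @ \oo --> maxplus_ereal a.

Lemma mp_ereal_le a b : (maxplus_ereal a <= maxplus_ereal b)%E = (a <=t b).
Proof. by case: a b => [a|] [b|] /=; rewrite ?lee_fin ?leNye // leeNy_eq. Qed.

Lemma mp_ereal_inj : injective (@maxplus_ereal R).
Proof. by move=> a b ab; apply: mple_anti; rewrite -mp_ereal_le ab. Qed.

Lemma mp_cvg_unique x a b : mp_cvg x a -> mp_cvg x b -> a = b.
Proof.
move=> xa xb; apply: mp_ereal_inj; apply: cvg_unique xa xb.
exact: ereal_hausdorff.
Qed.

Lemma mp_cvg_le x y a b :
  mp_cvg x a -> mp_cvg y b -> (forall k, x k <=t y k) -> a <=t b.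
Proof.
move=> xa yb xy; rewrite -mp_ereal_le; apply: lee_cvg_to xa yb _.
by apply: nearW => k; rewrite mp_ereal_le.
Qed.

Lemma mp_cvg_scale x a (c : R) :
  mp_cvg x a -> mp_cvg (fun k => Fin c * x k) (Fin c * a).
Proof.
have E b : maxplus_ereal (Fin c * b) = (c%:E + maxplus_ereal b)%E by case: b.
rewrite /mp_cvg E => xa.
rewrite (_ : (fun k => _) = (cst c%:E) \+ (fun k => maxplus_ereal (x k)))%E.
  apply: cvgeD => //; last exact: cvg_cst.
by apply/funext => k /=; rewrite E.
Qed.

Lemma mp_cvg_subseq x a (h : nat -> nat) :
  (forall j, (j <= h j)%N) -> mp_cvg x a -> mp_cvg (x \o h) a.
Proof.
move=> hj xa; have h_oo : h @ \oo --> \oo.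
  by move=> P [N _ NP]; exists N => // j /= Nj; apply: NP; apply: leq_trans Nj _.
exact: (cvg_comp _ _ h_oo xa).
Qed.

Lemma mp_cvg_near_ge x (t e : R) : 0 < e -> mp_cvg x (Fin t) ->
  \forall k \near \oo, Fin (t - e) <=t x k.
Proof.
move=> e0 xt; have /xt : ereal_nbhs t%:E (fun u => (t - e)%:E < u)%E.
  by apply: open_ereal_gt'; rewrite lte_fin; lra.
move=> H.
have {}H : \forall k \near \oo, ((t - e)%:E < maxplus_ereal (x k))%E by exact: H.
apply: filterS H  => k /ltW.
by rewrite -[(_)%:E]/(maxplus_ereal (Fin _)) mp_ereal_le.
Qed.

Lemma mp_cvg_near_le x (t e : R) : 0 < e -> mp_cvg x (Fin t) ->
  \forall k \near \oo, x k <=t Fin (t + e).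
Proof.
move=> e0 xt; have /xt : ereal_nbhs t%:E (fun u => u < (t + e)%:E)%E.
  by apply: open_ereal_lt'; rewrite lte_fin; lra.
move=> H.
have {}H : \forall k \near \oo, (maxplus_ereal (x k) < (t + e)%:E)%E by exact: H.
apply: filterS H  => k /ltW.
by rewrite -[(_)%:E]/(maxplus_ereal (Fin _)) mp_ereal_le.
Qed.

Lemma mp_cvg_near_cst x a : (\forall k \near \oo, x k = a) -> mp_cvg x a.
Proof.
move=> xa; apply: cvg_near_cst; apply: filterS xa => k ->; exact: erefl.
Qed.

Lemma mp_cvg0 x :
  (forall A : R, \forall k \near \oo, x k <=t Fin A) -> mp_cvg x 0.
Proof.
move=> xA; apply/cvgeNyPle => A; apply: filterS (xA A) => k.
by rewrite -mp_ereal_le.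
Qed.

End Limits.

Section Closure.
Local Open Scope classical_set_scope.
Variables (R : realType) (n : nat).
Implicit Types (A B L : 'M[maxplus R]_n).

Lemma proj_class_eqP A B :
  proj_class A = proj_class B <-> exists l : R, B = Fin l *: A.
Proof.
split=> [/eqmodP/asboolP //|H].
by apply/eqmodP/asboolP.
Qed.

Lemma proj_class_scale (l : R) A : proj_class (Fin l *: A) = proj_class A.
Proof. by apply/esym/proj_class_eqP; exists l. Qed.

Lemma proj_class_eq0 A : proj_class A = proj_class 0 -> A = 0.
Proof. by move/esym/proj_class_eqP => [l ->]; rewrite scaler0. Qed.

(** The scaled powers that converge to [L] are representatives as required by
    the convergence of classes; [L] has to be nonzero because the null class is
    isolated. *)
Lemma closure_of_cvg A (m : nat -> nat) (s : nat -> R) L :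
  L <> 0 -> (forall k, 1 <= m k)%N ->
  (forall u v, mp_cvg (fun k => Fin (s k) * (A ^+ m k) u v) (L u v)) ->
  proj_closure (power_classes A) (proj_class L).
Proof.
move=> L0 m1 cvgL; exists (fun k => proj_class (A ^+ m k)); split.
  by move=> k; exists (m k).
rewrite /proj_cvg; case: eqP => [/proj_class_eq0 //|_].
exists (fun k => Fin (s k) *: A ^+ m k), L; split=> // [k|u v].
  exact: proj_class_scale.
rewrite (_ : (fun k => _) =
  (fun k => maxplus_ereal (Fin (s k) * (A ^+ m k) u v))); first exact: cvgL.
by apply/funext => k; rewrite mxE.
Qed.

(** The first alternative is convergence to the isolated null class. *)
Lemma cvg_of_closure A B : proj_closure (power_classes A) (proj_class B) ->
  (exists2 k, (1 <= k)%N & A ^+ k = 0) \/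
  exists (m : nat -> nat) (s : nat -> R) L (l : R),
    [/\ B = Fin l *: L, L <> 0 &
     forall u v, mp_cvg (fun k => Fin (s k) * (A ^+ m k) u v) (L u v)].
Proof.
move=> [c [cA]]; rewrite /proj_cvg; case: eqP => [_ [N _ cN]|B0].
  left; have [k k1 ck] := cA N; exists k => //; apply: proj_class_eq0.
  by rewrite -ck cN /=.
move=> [M [L [Mc /proj_class_eqP[l lL] cvgM]]]; right.
have /choice[f fP] : forall k, exists z : nat * R, M k = Fin z.2 *: A ^+ z.1.
  move=> k; have [m _ mE] := cA k; have := Mc k; rewrite mE.
  by move=> /esym/proj_class_eqP[s sE]; exists (m, s).
exists (fun k => (f k).1), (fun k => (f k).2), L, l; split=> //.
  by move=> L0; apply: B0; rewrite lL L0 scaler0.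
move=> u v; have := cvgM u v; rewrite /mp_cvg.
rewrite (_ : (fun k => maxplus_ereal (M k u v)) =
  (fun k => maxplus_ereal (Fin (f k).2 * (A ^+ (f k).1) u v))) //.
by apply/funext => k; rewrite fP mxE.
Qed.

End Closure.

(** * Lower bound for the rank of limits *)

(** Otherwise each value stops to occur from some index on, and no value is
    left beyond the largest of these indices. *)
Lemma frequent_value (T : finType) (G : nat -> T) :
  exists (g : T) (h : nat -> nat), forall j, (j <= h j)%N /\ G (h j) = g.
Proof.
suff [g gP] : exists g, forall j, exists k, (j <= k)%N /\ G k = g.
  by have [h hP] := choice gP; exists g, h.
apply/not_existsP => none.
have /choice[K KP] : forall g, exists j, forall k, (j <= k)%N -> G k <> g.
  move=> g; have /existsNP[j jP] := none g; exists j => k jk Gk.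
  by apply: jP; exists k.
have KM : (K (G (\max_g K g)) <= \max_g K g)%N by apply: leq_bigmax.
exact: (KP _ _ KM).
Qed.

Lemma third_lt (R : realFieldType) (T d : R) :
  0 < d -> T + d / 3 - d < T - d / 3.
Proof. by move=> d0; lra. Qed.

Section LowerBound.
Local Open Scope classical_set_scope.
Variables (R : realType) (n : nat) (A B : 'M[maxplus R]_n) (l : R).
Variable p : 'I_n -> R.
Hypothesis B_le1 : forall u v, B u v <=t 1.
Hypothesis AE : forall u v, A u v = Fin (l - p u + p v) * B u v.

(** In each power of [B] the chosen submatrix has zeros on the diagonal, no
    positive entry, and no other permutation made of zeros.  The gap below 0
    carries this over to the limits. *)
Lemma limit_rank_ge r (a : 'I_r -> 'I_n) :
  (0 < r)%N -> injective a ->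
  (forall k, exists g : {ffun 'I_r -> 'I_n},
     [/\ injective g, forall i, zero_walk B k (a i) (g i) &
      forall s : 'S_r, (forall i, zero_walk B k (a i) (g (s i))) -> s = 1%g]) ->
  forall (m : nat -> nat) (s : nat -> R) (L : 'M[maxplus R]_n) (z : R),
  L <> 0 ->
  (forall u v, mp_cvg (fun k => Fin (s k) * (A ^+ m k) u v) (L u v)) ->
  (r <= tropical_rank (Fin z *: L))%N.
Proof.
move=> r0 a_inj /choice[g gP] m s L z L0 cvgL.
pose t k := s k + (m k)%:R * l.
pose L' u v := Fin (p u - p v) * L u v.
have cvgL' u v : mp_cvg (fun k => Fin (t k) * (B ^+ m k) u v) (L' u v).
  rewrite (_ : (fun k => _) =
      fun k => Fin (p u - p v) * (Fin (s k) * (A ^+ m k) u v)).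
    exact: mp_cvg_scale.
  apply/funext => k; rewrite (pow_scaled AE) !mulrA !mp_FinM.
  by congr (_ * _); congr Fin; rewrite /t; ring.
have [G [h hP]] := frequent_value (fun k => g (m k)).
have h_ge j : (j <= h j)%N by case: (hP j).
have hG j : g (m (h j)) = G by case: (hP j).
have [G_inj _ _] := gP (m (h 0%N)); rewrite hG in G_inj.
have diag i j : zero_walk B (m (h j)) (a i) (G i).
  by have [_ + _] := gP (m (h j)); rewrite hG.
have uniq1 j (q : 'S_r) :
    (forall i, zero_walk B (m (h j)) (a i) (G (q i))) -> q = 1%g.
  by have [_ _ +] := gP (m (h j)); rewrite hG; apply.
have cvgN u v := mp_cvg_subseq h_ge (cvgL' u v).
pose i0 := Ordinal r0; pose tau := L' (a i0) (G i0).
have cvgt : mp_cvg (fun j => Fin (t (h j))) tau.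
  have := cvgN (a i0) (G i0); congr (mp_cvg _ _).
  by apply/funext => j /=; rewrite diag mulr1.
have le_tau u v : L' u v <=t tau.
  apply: mp_cvg_le (cvgN u v) cvgt _ => j /=.
  exact: mp_mul_le_left (pow_le1 B_le1 _ _ _).
have L'diag i : L' (a i) (G i) = tau.
  apply: mp_cvg_unique (cvgN _ _) _.
  by congr (mp_cvg _ _): cvgt; apply/funext => j /=; rewrite diag mulr1.
have [T tauE] : exists T, tau = Fin T.
  case E: tau => [T|]; first by exists T.
  case: L0; apply/matrixP => u v; rewrite mxE.
  have := le_tau u v; rewrite E => /mple0; rewrite /L' => E0.
  by rewrite -(mp_FinVK (p u - p v) (L u v)) E0.
rewrite tauE in cvgt le_tau L'diag.
apply: tropical_rank_ge; apply: (has_nonsingular_submx_inj a_inj G_inj).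
pose M : 'M[maxplus R]_r := \matrix_(i, j) (Fin (- T) * L' (a i) (G j)).
apply: (@nonsingular_scale _ _ M _
         (fun i => T + z - p (a i)) (fun j => p (G j))).
  move=> i j; rewrite !mxE /L' mulrAC !mulrA !mp_FinM; congr (_ * _).
  by congr Fin; ring.
have M_le1 i j : M i j <=t 1.
  rewrite mxE; apply: mple_trans (mple_mull _ (le_tau _ _)) _.
  by rewrite mp_FinM addNr mple_refl.
have pw1 : perm_weight M 1%g = 1.
  rewrite /perm_weight big1 // => i _.
  by rewrite perm1 mxE L'diag mp_FinM addNr.
apply/nonsingularP; exists 1%g; rewrite pw1; split=> // q q1; apply/negP => le_q.
have M1 i : M i (q i) = 1.
  move: i; apply: mp_prod_eq1; first by move=> i; apply: M_le1.
  by apply: mple_anti le_q; apply: mp_prod_le1 => i _; apply: M_le1.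
have [d d0 gap] := zero_walk_gap B_le1.
have d3 : 0 < d / 3 by lra.
have near_t := mp_cvg_near_le d3 cvgt.
have near_L : \forall j \near \oo, forall i : 'I_r,
    Fin (T - d / 3) <=t Fin (t (h j)) * (B ^+ m (h j)) (a i) (G (q i)).
  apply: filter_forall => i; apply: (mp_cvg_near_ge d3).
  have <- : L' (a i) (G (q i)) = Fin T.
    rewrite -(mp_FinKV T (L' _ _)); have := M1 i; rewrite mxE => ->.
    by rewrite mulr1.
  exact: cvgN.
have [j [jt jL]] : exists j, Fin (t (h j)) <=t Fin (T + d / 3) /\ forall i : 'I_r,
    Fin (T - d / 3) <=t Fin (t (h j)) * (B ^+ m (h j)) (a i) (G (q i)).
  by have [j jP] := filter_ex (filterI near_t near_L); exists j.
case/eqP: q1; apply: (uniq1 j) => i.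
case: (gap (m (h j)) (a i) (G (q i))) => // small.
have := mple_trans (jL i) (mple_mul jt small).
by have := third_lt T d0; rewrite ltNge => /negP.
Qed.

End LowerBound.

(** * Cyclic classes of the critical graph *)

Section CriticalClasses.
Variables (R : realType) (n : nat) (B : 'M[maxplus R]_n).
Hypothesis B_le1 : forall u v, B u v <=t 1.
Implicit Types u v w a : 'I_n.

Definition zero_reach u v : Prop := exists k, zero_walk B k u v.
Definition critical u : Prop := exists2 b, (0 < b)%N & zero_walk B b u u.
Definition critical_arc u v : Prop := B u v = 1 /\ zero_reach v u.

(** Quantifying over all moduli [N] avoids naming the period of a component. *)
Definition same_class u v : Prop := forall N, (0 < N)%N ->
  (exists m, zero_walk B (m * N) u v) /\ (exists m, zero_walk B (m * N) v u).

Lemma zero_reach_trans u w v :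
  zero_reach u w -> zero_reach w v -> zero_reach u v.
Proof.
by move=> [k uw] [k' wv]; exists (k + k')%N; apply: (zero_walk_cat B_le1 uw wv).
Qed.

Lemma same_class_refl u : same_class u u.
Proof. by move=> N _; split; exists 0%N; apply: zero_walk0. Qed.

Lemma same_class_sym u v : same_class u v -> same_class v u.
Proof. by move=> uv N N0; have [] := uv N N0. Qed.

Lemma same_class_trans u w v :
  same_class u w -> same_class w v -> same_class u v.
Proof.
move=> uw wv N N0; have [[a ua] [a' wa]] := uw N N0.
have [[b wb] [b' vb]] := wv N N0.
split; [exists (a + b)%N|exists (b' + a')%N]; rewrite mulnDl.
  exact: (zero_walk_cat B_le1 ua wb).
exact: (zero_walk_cat B_le1 vb wa).
Qed.

(** If [v] returns to [u] in [k] steps, turning [N] times around the closed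
    walk of length [k.+1] through the arc, but for the arc itself, leads from
    [v] to [u] in [N * k.+1 - 1] steps; a walk from [u] to [u'] and the second
    arc then complete a length that [N] divides. *)
Lemma same_class_succ u v u' v' :
  critical_arc u v -> critical_arc u' v' -> same_class u u' ->
  same_class v v'.
Proof.
suff half x y x' y' : critical_arc x y -> critical_arc x' y' ->
    same_class x x' ->
    forall N, (0 < N)%N -> exists m, zero_walk B (m * N) y y'.
  move=> uv uv' uu' N N0; split; first exact: (half u v u' v').
  by apply: (half u' v' u v) => //; apply: same_class_sym.
move=> [xy1 [k yx]] [xy1' _] xx' [//|N] N0.
have [xy xy'] : zero_walk B 1 x y /\ zero_walk B 1 x' y'.
  by split; apply/zero_walk1.
have [[m xm] _] := xx' N.+1 N0.
have xx : zero_walk B (1 + k) x x by apply: (zero_walk_cat B_le1 xy yx).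
have yx' := zero_walk_cat B_le1 yx (zero_walk_loop B_le1 N xx).
have := zero_walk_cat B_le1 (zero_walk_cat B_le1 yx' xm) xy'.
set len := (_ + 1)%N => yy'; exists (k.+1 + m)%N.
by rewrite (_ : (_ * _)%N = len) // /len; lia.
Qed.

Lemma critical_succ u : critical u -> exists v, critical_arc u v.
Proof.
move=> [[//|b] _]; rewrite -add1n => /(zero_walk_split B_le1)[v [uv vu]].
by exists v; split; [apply/zero_walk1|exists b].
Qed.

Lemma critical_pred u : critical u -> exists v, critical_arc v u.
Proof.
move=> [[//|b] _]; rewrite -addn1 => /(zero_walk_split B_le1)[v [uv vu]].
by exists v; split; [apply/zero_walk1|exists b].
Qed.

Lemma critical_arcl u v : critical_arc u v -> critical u.
Proof.
move=> [uv1 [k vu]]; have uv : zero_walk B 1 u v by apply/zero_walk1.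
exists (1 + k)%N => //.
exact: (zero_walk_cat B_le1 uv vu).
Qed.

Lemma critical_arcr u v : critical_arc u v -> critical v.
Proof.
move=> [uv1 [k vu]]; have uv : zero_walk B 1 u v by apply/zero_walk1.
exists (k + 1)%N; first by rewrite addn1.
exact: (zero_walk_cat B_le1 vu uv).
Qed.

Lemma same_class_critical u v : critical u -> same_class u v -> critical v.
Proof.
move=> [b b0 uu] uv; have [[m um] [m' vm]] := uv 1%N isT.
exists (m' * 1 + (b + m * 1))%N; first lia.
by apply: (zero_walk_cat B_le1 vm _) => //; apply: (zero_walk_cat B_le1 uu um).
Qed.

(** Cut a sufficiently long closed walk after [k] steps. *)
Lemma critical_walk u k :
  critical u -> exists v, zero_walk B k u v /\ zero_reach v u.
Proof.
move=> [b b0 uu]; have := zero_walk_loop B_le1 k uu.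
rewrite -{1}(subnKC (leq_pmulr k b0)) => /(zero_walk_split B_le1)[v [uv vu]].
by exists v; split=> //; exists (k * b - k)%N.
Qed.

Lemma critical_period :
  exists2 N, (0 < N)%N & forall u, critical u -> zero_walk B N u u.
Proof.
have /choice[b bP] : forall u, exists b,
    (0 < b)%N /\ (critical u -> zero_walk B b u u).
  move=> u; have [[b b0 uu]|] := pselect (critical u); first by exists b.
  by exists 1%N.
exists (\prod_u b u)%N; first by apply: prodn_gt0 => u; case: (bP u).
move=> u crit_u; rewrite (bigD1 u) //= mulnC.
by apply: (zero_walk_loop B_le1) => //; case: (bP u) => _; apply.
Qed.

Section Labels.
Variables (cl f : 'I_n -> 'I_n) (F : {set 'I_n}).
Hypothesis cl_idem : forall u, cl (cl u) = cl u.
Hypothesis cl_sound : forall u, same_class u (cl u).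
Hypothesis cl_arc : forall u v, critical_arc u v -> cl v = cl (f (cl u)).
Hypothesis FP : forall u, u \in F <-> critical u /\ cl u = u.

Let next a := cl (f a).

Lemma label_in u : critical u -> cl u \in F.
Proof.
move=> crit_u; apply/FP; split; last exact: cl_idem.
exact: same_class_critical crit_u (cl_sound u).
Qed.

Lemma label_fix a : a \in F -> cl a = a.
Proof. by case/FP. Qed.

Lemma next_in a : a \in F -> next a \in F.
Proof.
move=> aF; have [/critical_succ[v av] ca] : critical a /\ cl a = a by apply/FP.
rewrite /next -{1}ca -(cl_arc av); exact: label_in (critical_arcr av).
Qed.

(** Every critical node has a critical predecessor, so [next] is onto the
    finite set [F]. *)
Lemma next_inj : {in F &, injective next}.
Proof.
apply/imset_injP; rewrite eqn_leq leq_imset_card /=.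
apply/subset_leq_card/fintype.subsetP => b bF.
have [/critical_pred[w wb] cb] : critical b /\ cl b = b by apply/FP.
apply/imsetP; exists (cl w); first exact: label_in (critical_arcl wb).
by rewrite /next -(cl_arc wb).
Qed.

Lemma iter_next_in k a : a \in F -> iter k next a \in F.
Proof. by move=> aF; elim: k => //= k; apply: next_in. Qed.

Lemma iter_next_inj k : {in F &, injective (iter k next)}.
Proof.
elim: k => //= k IH a b aF bF /next_inj E.
by apply: IH => //; apply: E; apply: iter_next_in.
Qed.

(** Along a closed walk every arc is critical, and labels follow [next]. *)
Lemma label_walk k u v :
  zero_walk B k u v -> zero_reach v u -> cl v = iter k next (cl u).
Proof.
elim: k u => [|k IH] u.
  by move=> /zero_walk0_eq ->.
rewrite -add1n => /(zero_walk_split B_le1)[w [uw wv]] vu.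
have reach_wu : zero_reach w u by apply: zero_reach_trans vu; exists k.
have reach_vw : zero_reach v w by apply: zero_reach_trans vu _; exists 1%N.
rewrite (IH w wv reach_vw) iterSr; congr iter.
by apply: cl_arc; split=> //; apply/zero_walk1.
Qed.

(** The columns are reached from the rows by [k] critical steps.  If a
    permutation [s] admits zero walks as well, each row leads to the next one
    along the cycles of [s], hence also back; all these walks are then critical,
    and the label at their end is [k] times the next of the label at their
    origin.  As [next] is injective, [s] fixes every row. *)
Lemma label_columns k :
  exists g : {ffun 'I_#|F| -> 'I_n},
    [/\ injective g, forall i, zero_walk B k (enum_val i) (g i) &
     forall s : 'S_#|F|,
       (forall i, zero_walk B k (enum_val i) (g (s i))) -> s = 1%g].
Proof.
have aF (i : 'I_#|F|) : enum_val i \in F by apply: enum_valP.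
have /choice[g gP] : forall i : 'I_#|F|, exists v,
    zero_walk B k (enum_val i) v /\ zero_reach v (enum_val i).
  by move=> i; apply: critical_walk; have /FP[] := aF i.
have clg (i : 'I_#|F|) v :
    zero_walk B k (enum_val i) v -> zero_reach v (enum_val i) ->
    cl v = iter k next (enum_val i).
  by move=> iv vi; rewrite (label_walk iv vi) (label_fix (aF i)).
have inj_lab (i j : 'I_#|F|) :
    iter k next (enum_val i) = iter k next (enum_val j) -> i = j.
  by move=> /iter_next_inj E; apply: enum_val_inj; apply: E.
exists [ffun i => g i]; split.
- move=> i j; rewrite !ffunE => gij; apply: inj_lab.
  have [gi ri] := gP i; have [gj rj] := gP j.
  by rewrite -(clg _ _ gi ri) -(clg _ _ gj rj) gij.
- by move=> i; rewrite ffunE; case: (gP i).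
- move=> s sP; have stepP i : zero_reach (enum_val i) (enum_val (s i)).
    have [_ ri] := gP (s i); apply: zero_reach_trans ri.
    by exists k; have := sP i; rewrite ffunE.
  have iterP m i : zero_reach (enum_val i) (enum_val ((s ^+ m)%g i)).
    elim: m => [|m IH]; first by rewrite perm1; exists 0%N; apply: zero_walk0.
    by apply: zero_reach_trans IH _; rewrite expgSr permM.
  apply/permP => i; rewrite perm1; apply/esym/inj_lab.
  have [gsi rsi] := gP (s i).
  rewrite -(clg _ _ gsi rsi); apply/esym/clg.
    by have := sP i; rewrite ffunE.
  apply: zero_reach_trans rsi _.
  (* the powers of the permutation lead back from [s i] to [i] *)
  have := iterP #[s]%g.-1 (s i); rewrite -permM -expgS prednK ?order_gt0 //.
  by rewrite expg_order perm1.
Qed.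

End Labels.
End CriticalClasses.

(** * A limit of small factor rank *)

Lemma pow_le_fin (R : realType) n (M : 'M[maxplus R]_n) (c : R) :
  (forall u v, M u v <=t Fin c) ->
  forall q u v, (M ^+ q) u v <=t Fin (q%:R * c).
Proof.
move=> Mc; elim=> [|q IH] u v.
  rewrite mx_pow0 mul0r; case: (u == v); [exact: mple_refl|exact: mp0le].
rewrite mx_powS; apply: mp_sum_le => w _.
apply: mple_trans (mple_mul (Mc u w) (IH w v)) _.
by rewrite mp_FinM -nat1r mulrDl mul1r mple_refl.
Qed.

(** Here [C] plays the role of a power of a matrix: nodes on a closed walk of
    weight 0 carry a loop of weight 0. *)
Section UpperBound.
Local Open Scope classical_set_scope.
Variables (R : realType) (n : nat) (C : 'M[maxplus R]_n).
Variables (F : {set 'I_n}) (cl : 'I_n -> 'I_n).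
Hypothesis C_le1 : forall u v, C u v <=t 1.
Hypothesis C_loop : forall u b, (0 < b)%N -> zero_walk C b u u -> C u u = 1.
Hypothesis cl_in : forall u, C u u = 1 -> cl u \in F.
Hypothesis cl_walk : forall u, C u u = 1 ->
  zero_reach C u (cl u) /\ zero_reach C (cl u) u.
Hypothesis F_loop : forall u, u \in F -> C u u = 1.

Let E u v := \sum_(r in F) (C ^+ n) u r * (C ^+ n) r v.

Lemma loop_pow k r : C r r = 1 -> zero_walk C k r r.
Proof.
move=> rr; rewrite -(muln1 k); apply: (zero_walk_loop C_le1).
by apply/zero_walk1.
Qed.

(** Closed subwalks are never profitable, so length beyond [n] can be cut out,
    and the loop at [r] makes up for missing length. *)
Lemma pow_to_loop k u r : C r r = 1 -> (C ^+ k) u r <=t (C ^+ n) u r.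
Proof.
move=> rr; elim/ltn_ind: k => k IH; have [kn|nk] := leqP k n.
  have := mx_pow_le C k (n - k) u r r.
  by rewrite (loop_pow _ rr) mulr1 subnKC.
have [w [a [b [c [b0 abc le_w]]]]] := mx_pow_cycle C u r (ltnW nk).
apply: mple_trans le_w _.
apply: mple_trans (mple_mulr _ (mp_mul_le_left _ (pow_le1 C_le1 _ _ _))) _.
apply: mple_trans (mx_pow_le _ _ _ _ _ _) _.
by apply: IH; lia.
Qed.

Lemma pow_from_loop k r v : C r r = 1 -> (C ^+ k) r v <=t (C ^+ n) r v.
Proof.
move=> rr; elim/ltn_ind: k => k IH; have [kn|nk] := leqP k n.
  have := mx_pow_le C (n - k) k r r v.
  by rewrite (loop_pow _ rr) mul1r subnK.
have [w [a [b [c [b0 abc le_w]]]]] := mx_pow_cycle C r v (ltnW nk).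
apply: mple_trans le_w _.
apply: mple_trans (mple_mulr _ (mp_mul_le_left _ (pow_le1 C_le1 _ _ _))) _.
apply: mple_trans (mx_pow_le _ _ _ _ _ _) _.
by apply: IH; lia.
Qed.

(** The label of [r] is reached from [r] and leads back to [r] for free, hence
    replaces [r] as the intermediate node. *)
Lemma through_loop_le r u v : C r r = 1 ->
  (C ^+ n) u r * (C ^+ n) r v <=t E u v.
Proof.
move=> rr; have [[k rc] [k' cr]] := cl_walk rr; have cF := cl_in rr.
have le_F := mp_le_sumT (P := [in F])
  (fun r => (C ^+ n) u r * (C ^+ n) r v) cF.
apply: mple_trans le_F; apply: mple_mul.
  have := mx_pow_le C n k u r (cl r); rewrite rc mulr1 => /mple_trans; apply.
  exact: pow_to_loop (F_loop cF).
have := mx_pow_le C k' n (cl r) r v; rewrite cr mul1r => /mple_trans; apply.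
exact: pow_from_loop (F_loop cF).
Qed.

Lemma le_pow_through k u v : (n + n <= k)%N -> E u v <=t (C ^+ k) u v.
Proof.
move=> nk; apply: mp_sum_le => r rF; have rr := F_loop rF.
have -> : k = (n + (k - (n + n) + n))%N by lia.
apply: mple_trans (mx_pow_le C _ _ u r v); apply: mple_mull.
by have := mx_pow_le C (k - (n + n)) n r r v; rewrite (loop_pow _ rr) mul1r.
Qed.

Let C0 : 'M[maxplus R]_n := \matrix_(u, v) if C u u == 1 then 0 else C u v.

Lemma C0_le u v : C0 u v <=t C u v.
Proof. by rewrite mxE; case: ifP => _; [exact: mp0le|exact: mple_refl]. Qed.

(** A walk either avoids the nodes with a loop of weight 0, or can be cut at
    the first of them. *)
Lemma pow_le_transient k u v : (C ^+ k) u v <=t (C0 ^+ k) u v + E u v.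
Proof.
elim: k u => [|k IH] u; first by rewrite !mx_pow0 mp_add_left.
have [uu|uu] := eqVneq (C u u) 1.
  apply: mple_trans (mp_add_right _ _).
  apply: mple_trans (through_loop_le u v uu).
  by rewrite (loop_pow n uu) mul1r; apply: pow_from_loop.
rewrite mx_powS; apply: mp_sum_le => w _.
apply: mple_trans (mple_mull _ (IH w)) _; rewrite mulrDr; apply: mple_add.
  rewrite mx_powS.
  have -> : C u w = C0 u w by rewrite mxE (negbTE uu).
  exact: (mp_le_sumT (P := xpredT) (fun w => C0 u w * (C0 ^+ k) w v)).
rewrite mulr_sumr; apply: mp_sum_le => r rF.
apply: mple_trans (through_loop_le u v (F_loop rF)); rewrite mulrA.
apply: mple_mulr; have := mx_pow_le C 1 n u w r; rewrite expr1.
by move=> /mple_trans; apply; apply: pow_to_loop; apply: F_loop.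
Qed.

(** A walk of length [n] avoiding these nodes has no closed subwalk of weight
    0, hence has a nonzero arc. *)
Lemma transient_decay :
  exists2 d : R, 0 < d & forall q u v, (C0 ^+ (n * q)) u v <=t Fin (q%:R * - d).
Proof.
have C0_le1 u v : C0 u v <=t 1 by apply: mple_trans (C0_le u v) (C_le1 u v).
have [d d0 gap] := zero_walk_gap C0_le1.
exists d => // q u v; rewrite exprM; apply: pow_le_fin => {u v} u v.
case: (gap n u v) => // uv.
have [w [b [b0 ww]]] := zero_walk_cycle C0_le1 (leqnn n) uv.
have pow_mono k x y : (C0 ^+ k) x y <=t (C ^+ k) x y.
  elim: k x => [|k IH] x; first by rewrite !mx_pow0 mple_refl.
  rewrite !mx_powS; apply: mp_sum_le => z _.
  apply: mple_trans (mple_mul (C0_le x z) (IH z)) _.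
  exact: (mp_le_sumT (P := xpredT) (fun z => C x z * (C ^+ k) z y)).
have /(C_loop b0) Cww : zero_walk C b w w.
  apply: mple_anti; first exact: pow_le1.
  by have := pow_mono b w w; rewrite ww.
case: b b0 ww => // b _; rewrite -add1n => /(zero_walk_split C0_le1)[x [wx _]].
move/zero_walk1: wx; rewrite mxE Cww eqxx => /eqP.
by rewrite eq_sym oner_eq0.
Qed.

(** Where [E u v] is finite the sequence becomes constant, because the walks
    that avoid the loops drop below [E u v].  Lengths from [n * 2] on suffice
    for the lower estimate, hence the shift of [q]. *)
Lemma pow_cvg u v : mp_cvg (fun q => (C ^+ (n * q.+2)) u v) (E u v).
Proof.
have [d d0 decay] := transient_decay.
have near_decay (A : R) : \forall q \near \oo, (C0 ^+ (n * q.+2)) u v <=t Fin A.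
  have /cvgryPge/(_ (- A / d)) := @cvgr_idn R.
  apply: filterS => q qA; apply: mple_trans (decay q.+2 u v) _.
  have {}qA : - A <= q%:R * d by rewrite -ler_pdivrMr.
  rewrite /maxplus_le mulrN lerNl; apply: le_trans qA _.
  by rewrite ler_pM2r // ler_nat; lia.
have ge_E q : E u v <=t (C ^+ (n * q.+2)) u v.
  by apply: le_pow_through; rewrite addnn -mul2n mulnC leq_mul2l; lia.
case EE: (E u v) => [e|].
  apply: mp_cvg_near_cst; apply: filterS (near_decay e) => q le_e.
  apply: mple_anti; last by rewrite -EE.
  apply: mple_trans (pow_le_transient _ _ _) _; rewrite EE.
  by apply: mp_add_lub => //; apply: mple_refl.
apply: mp_cvg0 => A; apply: filterS (near_decay A) => q le_A.
apply: mple_trans (pow_le_transient _ _ _) _; rewrite EE.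
by apply: mp_add_lub => //; apply: mp0le.
Qed.

End UpperBound.

(** * The ultimate rank *)

Section UltimateRank.
Variables (R : realType) (n : nat) (A B : 'M[maxplus R]_n) (l : R).
Variables (p : 'I_n -> R) (cl f : 'I_n -> 'I_n) (F : {set 'I_n}).
Hypothesis B_le1 : forall u v, B u v <=t 1.
Hypothesis AE : forall u v, A u v = Fin (l - p u + p v) * B u v.
Hypothesis cl_idem : forall u, cl (cl u) = cl u.
Hypothesis cl_sound : forall u, same_class B u (cl u).
Hypothesis cl_arc : forall u v, critical_arc B u v -> cl v = cl (f (cl u)).
Hypothesis FP : forall u, u \in F <-> critical B u /\ cl u = u.
Hypothesis crit_ex : exists u, critical B u.

Lemma labels_neq0 : (0 < #|F|)%N.
Proof.
have [u crit_u] := crit_ex; apply/card_gt0P; exists (cl u).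
exact: (label_in B_le1 cl_idem cl_sound FP).
Qed.

Lemma pow_neq0 k : A ^+ k != 0.
Proof.
apply/eqP => /matrixP Ak0; have [u crit_u] := crit_ex.
have [v [uv _]] := critical_walk B_le1 k crit_u.
by have := Ak0 u v; rewrite (pow_scaled AE) uv mulr1 mxE.
Qed.

Lemma ultimate_rank_ge : (#|F| <= ultimate_rank A)%N.
Proof.
rewrite /ultimate_rank; case: ex_minnP => r /asboolP[B0 [clB <-]] _.
case: (cvg_of_closure clB) => [[k _ Ak]|[m [s [L [z [-> L0 cvgL]]]]]].
  by have := pow_neq0 k; rewrite Ak eqxx.
apply: (limit_rank_ge B_le1 AE labels_neq0 (@enum_val_inj _ _) _ z L0 cvgL).
move=> k; exact: (label_columns B_le1 cl_idem cl_sound cl_arc FP).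
Qed.

(** The powers with exponents [N * n * (q + 2)], scaled by multiples of [l],
    converge to [L], a product through the indices in [F]. *)
Lemma ultimate_rank_le : (ultimate_rank A <= #|F|)%N.
Proof.
have [N N0 period] := critical_period B_le1.
pose C := B ^+ N.
have CE k : C ^+ k = B ^+ (N * k) by rewrite exprM.
have C_le1 u v : C u v <=t 1 by apply: pow_le1.
have C_crit u : C u u = 1 <-> critical B u.
  by split=> [uu|]; [exists N|exact: period].
have C_loop u b : (0 < b)%N -> zero_walk C b u u -> C u u = 1.
  move=> b0; rewrite /zero_walk CE => uu; apply/C_crit.
  by exists (N * b)%N => //; rewrite muln_gt0 N0.
have cl_in u : C u u = 1 -> cl u \in F.
  by move=> /C_crit; apply: (label_in B_le1 cl_idem cl_sound FP).
have cl_walk u : C u u = 1 -> zero_reach C u (cl u) /\ zero_reach C (cl u) u.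
  move=> _; have [[m uc] [m' cu]] := cl_sound u N0.
  by split; [exists m|exists m']; rewrite /zero_walk CE mulnC.
have F_loop u : u \in F -> C u u = 1 by case/FP => /C_crit.
have cvgC := pow_cvg C_le1 C_loop cl_in cl_walk F_loop.
pose L : 'M[maxplus R]_n := \matrix_(u, v)
  \sum_(r in F) (Fin (- p u) * (C ^+ n) u r) * ((C ^+ n) r v * Fin (p v)).
have LE u v : L u v = Fin (- p u + p v) *
    \sum_(r in F) (C ^+ n) u r * (C ^+ n) r v.
  rewrite mxE mulr_sumr; apply: eq_bigr => r _.
  by rewrite [_ * Fin (p v)]mulrC mulrACA mp_FinM.
have rankL : (tropical_rank L <= #|F|)%N.
  apply: (@tropical_rank_factor _ _ _ F L (fun u r => Fin (- p u) * (C ^+ n) u r)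
            (fun r v => (C ^+ n) r v * Fin (p v))).
  by move=> u v; rewrite mxE.
apply: leq_trans rankL; rewrite /ultimate_rank; case: ex_minnP => rk _; apply.
apply/asboolP; exists L; split=> //.
have n0 : (0 < n)%N by case: crit_ex => u _; apply: leq_ltn_trans (ltn_ord u).
pose m q := (N * (n * q.+2))%N.
apply: (@closure_of_cvg _ _ A m (fun q => - ((m q)%:R * l))).
- have [u crit_u] := crit_ex.
  have uF := label_in B_le1 cl_idem cl_sound FP crit_u.
  move/matrixP/(_ (cl u) (cl u)); rewrite LE mxE addNr.
  suff -> : \sum_(r in F) (C ^+ n) (cl u) r * (C ^+ n) r (cl u) = 1.
    by rewrite mulr1.
  have loop := loop_pow C_le1 n (F_loop _ uF).
  apply: mple_anti.
    by apply: mp_sum_le => r _; apply: mp_mul_le1; apply: pow_le1.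
  have := mp_le_sumT (P := [in F])
    (fun r => (C ^+ n) (cl u) r * (C ^+ n) r (cl u)) uF.
  by rewrite /= loop mulr1.
- by move=> q; rewrite /m !muln_gt0 N0 n0.
- move=> u v; rewrite LE.
  rewrite (_ : (fun k => _) =
      fun k => Fin (- p u + p v) * (C ^+ (n * k.+2)) u v).
    exact: mp_cvg_scale.
  apply/funext => k; rewrite (pow_scaled AE) mulrA mp_FinM CE.
  by congr (_ * _); congr Fin; ring.
Qed.

(** The set [F] contains one node of each cyclic class of the critical graph. *)
Theorem ultimate_rank_labels : ultimate_rank A = #|F|.
Proof. by apply/eqP; rewrite eqn_leq ultimate_rank_le ultimate_rank_ge. Qed.

End UltimateRank.

Lemma ultimate_rank_nilpotent (R : realType) n (A : 'M[maxplus R]_n) k :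
  (1 <= k)%N -> A ^+ k = 0 -> ultimate_rank A = 0%N.
Proof.
move=> k1 Ak; apply/eqP; rewrite -leqn0 /ultimate_rank.
case: ex_minnP => r _; apply; apply/asboolP; exists 0; split.
  by apply: sub_proj_closure; exists k => //; rewrite Ak.
apply/eqP; rewrite -leqn0 -(cards0 'I_n).
apply: (@tropical_rank_factor _ _ _ finset.set0 _ (fun _ _ => 0) (fun _ _ => 0)).
by move=> i j; rewrite mxE big_set0.
Qed.

(** * Programs with bounded loops *)

(** All loops run a variable through [0, ..., n - 1].  Such programs always
    halt, so that their semantics is a function and their running time can be
    read off from the nesting of the loops. *)
Inductive prog : Type :=
| PSkip
| PSetI of nat & iexp
| PSetT of nat & texp
| PSetIArr of nat & iexp & iexp & iexp
| PSetTArr of nat & iexp & iexp & texp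
| PSeq of prog & prog
| PIf of bexp & prog & prog
| PFor of nat & prog.

Fixpoint compile (c : prog) : cmd :=
  match c with
  | PSkip => CSkip
  | PSetI v e => CSetI v e
  | PSetT v e => CSetT v e
  | PSetIArr a e1 e2 e => CSetIArr a e1 e2 e
  | PSetTArr a e1 e2 e => CSetTArr a e1 e2 e
  | PSeq c1 c2 => CSeq (compile c1) (compile c2)
  | PIf b c1 c2 => CIf b (compile c1) (compile c2)
  | PFor v c1 =>
      CSeq (CSetI v (IConst 0))
        (CWhile (BNot (BLeI (IVar 0) (IVar v)))
          (CSeq (compile c1) (CSetI v (IAdd (IVar v) (IConst 1)))))
  end.

(** The variables ([kind] 0 and 2) and the arrays ([kind] 1 and 3) of natural
    and of max-plus numbers that a program may write. *)
Fixpoint written (kind : nat) (c : prog) : seq nat :=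
  match c with
  | PSkip => [::]
  | PSetI v _ => if kind == 0%N then [:: v] else [::]
  | PSetIArr a _ _ _ => if kind == 1%N then [:: a] else [::]
  | PSetT v _ => if kind == 2%N then [:: v] else [::]
  | PSetTArr a _ _ _ => if kind == 3%N then [:: a] else [::]
  | PSeq c1 c2 | PIf _ c1 c2 => written kind c1 ++ written kind c2
  | PFor v c1 => (if kind == 0%N then [:: v] else [::]) ++ written kind c1
  end.

Fixpoint loops_ok (c : prog) : bool :=
  match c with
  | PSeq c1 c2 | PIf _ c1 c2 => loops_ok c1 && loops_ok c2
  | PFor v c1 => [&& loops_ok c1, v \notin written 0 c1 & 0%N \notin written 0 c]
  | _ => true
  end.

Fixpoint nesting (c : prog) : nat :=
  match c with
  | PSeq c1 c2 | PIf _ c1 c2 => maxn (nesting c1) (nesting c2)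
  | PFor _ c1 => (nesting c1).+1
  | _ => 0%N
  end.

(** The constant factor in the running time.  Besides the body, an iteration
    of a loop takes 9 operations and its initialization and last test take 7,
    whence the 16. *)
Fixpoint weight (c : prog) : nat :=
  match c with
  | PSkip => 1%N
  | PSetI _ e => (icost e).+1
  | PSetT _ e => (tcost e).+1
  | PSetIArr _ e1 e2 e => (icost e1 + icost e2 + icost e).+1
  | PSetTArr _ e1 e2 e => (icost e1 + icost e2 + tcost e).+1
  | PSeq c1 c2 => (weight c1 + weight c2)%N
  | PIf b c1 c2 => (bcost b + weight c1 + weight c2).+1
  | PFor _ c1 => (weight c1 + 16)%N
  end.

Section ForPrograms.
Variable R : realType.
Implicit Types (s : state R) (c : prog).

(** The state after [k] iterations, with [k] already stored in [v]. *)
Fixpoint for_loop (body : state R -> state R) (v k : nat) s : state R :=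
  if k is k'.+1 then set_ivar (body (for_loop body v k' s)) v k
  else set_ivar s v 0.

Fixpoint feval c s : state R :=
  match c with
  | PSkip => s
  | PSetI v e => set_ivar s v (ieval s e)
  | PSetT v e => set_tvar s v (teval s e)
  | PSetIArr a e1 e2 e => set_iarr s a (ieval s e1) (ieval s e2) (ieval s e)
  | PSetTArr a e1 e2 e => set_tarr s a (ieval s e1) (ieval s e2) (teval s e)
  | PSeq c1 c2 => feval c2 (feval c1 s)
  | PIf b c1 c2 => if beval s b then feval c1 s else feval c2 s
  | PFor v c1 => for_loop (feval c1) v (ivar s 0) s
  end.

Definition unchanged c s s' : Prop :=
  [/\ forall v, v \notin written 0 c -> ivar s' v = ivar s v,
      forall a, a \notin written 1 c -> iarr s' a = iarr s a,
      forall v, v \notin written 2 c -> tvar s' v = tvar s v &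
      forall a, a \notin written 3 c -> tarr s' a = tarr s a].

Lemma unchanged_trans c1 c2 c s s1 s2 :
  (forall k, {subset written k c1 <= written k c}) ->
  (forall k, {subset written k c2 <= written k c}) ->
  unchanged c1 s s1 -> unchanged c2 s1 s2 -> unchanged c s s2.
Proof.
move=> sub1 sub2 [i1 ia1 t1 ta1] [i2 ia2 t2 ta2].
split=> x xc.
- by rewrite i2 ?i1 //; apply: contra xc => ?; [apply: sub1|apply: sub2].
- by rewrite ia2 ?ia1 //; apply: contra xc => ?; [apply: sub1|apply: sub2].
- by rewrite t2 ?t1 //; apply: contra xc => ?; [apply: sub1|apply: sub2].
- by rewrite ta2 ?ta1 //; apply: contra xc => ?; [apply: sub1|apply: sub2].
Qed.

Lemma unchanged_weak c c' s s' :
  (forall k, {subset written k c <= written k c'}) ->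
  unchanged c s s' -> unchanged c' s s'.
Proof.
move=> sub [i ia t ta]; split=> x xc; [apply: i|apply: ia|apply: t|apply: ta];
  by apply: contra xc => ?; apply: sub.
Qed.

Lemma unchanged_seti c v x s :
  v \in written 0 c -> unchanged c s (set_ivar s v x).
Proof.
move=> vc; split=> // y yc; rewrite /= /upd1; case: eqP => // yv.
by rewrite yv vc in yc.
Qed.

Lemma unchanged_for c v k s (body : state R -> state R) :
  (forall s, unchanged c s (body s)) ->
  unchanged (PFor v c) s (for_loop body v k s).
Proof.
move=> body_c; have vw : v \in written 0 (PFor v c) by rewrite mem_head.
elim: k => [|k IH]; first exact: unchanged_seti.
have sub kind : {subset written kind c <= written kind (PFor v c)}.
  by move=> x xc; rewrite /= mem_cat xc orbT.
apply: (unchanged_trans (fun _ _ => id) (fun _ _ => id) IH).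
exact: (unchanged_trans sub (fun _ _ => id) (body_c _) (unchanged_seti _ _ vw)).
Qed.

Lemma feval_unchanged c s : unchanged c s (feval c s).
Proof.
elim: c s => [|v e|v e|a e1 e2 e|a e1 e2 e|c1 IH1 c2 IH2|b c1 IH1 c2 IH2|v c IH] s.
- by split.
- by apply: unchanged_seti; rewrite mem_head.
- by split=> // x; rewrite inE /= /upd1 => /negbTE->.
- split=> // x; rewrite inE /= => /negbTE xa.
  by apply/funext => i; apply/funext => j; rewrite /upd3 xa.
- split=> // x; rewrite inE /= => /negbTE xa.
  by apply/funext => i; apply/funext => j; rewrite /upd3 xa.
- apply: (unchanged_trans _ _ (IH1 s) (IH2 _)) => k x xc; rewrite /= mem_cat xc //.
  by rewrite orbT.
- rewrite /=; case: ifP => _.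
    by apply: (unchanged_weak _ (IH1 s)) => k x xc; rewrite /= mem_cat xc.
  by apply: (unchanged_weak _ (IH2 s)) => k x xc; rewrite /= mem_cat xc orbT.
- exact: unchanged_for.
Qed.

Lemma for_loop_n c v k s : loops_ok (PFor v c) ->
  ivar (for_loop (feval c) v k s) 0 = ivar s 0.
Proof.
move=> /and3P[_ _ n0].
by have [-> //] := @unchanged_for c v k s (feval c) (feval_unchanged c).
Qed.

Lemma for_loop_index c v k s : ivar (for_loop (feval c) v k s) v = k.
Proof. by case: k => [|k]; rewrite /= /upd1 eqxx. Qed.

(** The invariant speaks of the state at the moment when the loop variable has
    just been set; everything the loop does not write is known to keep its
    initial value. *)
Lemma for_ind (I : nat -> state R -> Prop) v c s :
  I 0%N (set_ivar s v 0) ->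
  (forall k s', (k < ivar s 0)%N -> unchanged (PFor v c) s s' ->
     ivar s' v = k -> I k s' -> I k.+1 (set_ivar (feval c s') v k.+1)) ->
  I (ivar s 0) (feval (PFor v c) s).
Proof.
move=> I0 IS /=; set n := ivar s 0.
suff: forall k, (k <= n)%N -> I k (for_loop (feval c) v k s) by apply.
elim=> [|k IH] kn //=; apply: IS => //.
- by apply: unchanged_for; apply: feval_unchanged.
- exact: for_loop_index.
- by apply: IH; apply: ltnW.
Qed.

Lemma exec_for c v s (T : nat) : loops_ok (PFor v c) ->
  (forall s1, ivar s1 0 = ivar s 0 ->
     exists2 t, exec (compile c) s1 (feval c s1) t & (t <= T)%N) ->
  exists2 t, exec (compile (PFor v c)) s (feval (PFor v c) s) t &
    (t <= ivar s 0 * (T + 9) + 7)%N.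
Proof.
move=> ok body; set n := ivar s 0.
have iter_exec k : (k <= n)%N ->
  exists2 t, exec (CWhile (BNot (BLeI (IVar 0) (IVar v)))
          (CSeq (compile c) (CSetI v (IAdd (IVar v) (IConst 1)))))
      (for_loop (feval c) v (n - k) s) (for_loop (feval c) v n s) t &
    (t <= k * (T + 9) + 5)%N.
  elim: k => [|k IH] kn.
    exists 5%N => //; rewrite subn0; apply: ExecWhileStop.
    by rewrite /= negbK for_loop_index for_loop_n.
  have [t ex_t tk] := IH (ltnW kn).
  set s1 := for_loop (feval c) v (n - k.+1) s.
  have [t1 ex_t1 t1T] := body s1 (for_loop_n _ _ ok).
  have s1v : ivar (feval c s1) v = (n - k.+1)%N.
    have [iu _ _ _] := feval_unchanged c s1; rewrite iu; last by case/and3P: ok.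
    exact: for_loop_index.
  have nk : (n - k)%N = (n - k.+1).+1 by rewrite subnSK.
  exists (4 + (t1 + 4) + t).+1; last by rewrite mulSn; lia.
  apply: (@ExecWhileStep _ _ _ _ (for_loop (feval c) v (n - k) s)) => //.
    by rewrite /= -ltnNge for_loop_index for_loop_n // ltn_subrL; lia.
  apply: ExecSeq ex_t1 _; rewrite nk /= -/s1.
  have := ExecSetI (feval c s1) v (IAdd (IVar v) (IConst 1)).
  by rewrite /= s1v addn1.
have [t ex_t tn] := iter_exec n (leqnn n); rewrite subnn in ex_t.
exists (2 + t)%N; last by lia.
exact: ExecSeq (ExecSetI s v (IConst 0)) ex_t.
Qed.

(** Each level of nesting multiplies the time by [n]; the constants are
    collected in [weight]. *)
Lemma exec_feval c s : loops_ok c -> 0%N \notin written 0 c -> (0 < ivar s 0)%N ->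
  exists2 t, exec (compile c) s (feval c s) t &
    (t <= weight c * ivar s 0 ^ nesting c)%N.
Proof.
elim: c s => [|v e|v e|a e1 e2 e|a e1 e2 e|c1 IH1 c2 IH2|b c1 IH1 c2 IH2|v c IH]
  s ok n0w n0.
- by exists 1%N => //; apply: ExecSkip.
- by exists (icost e).+1; [apply: ExecSetI|rewrite muln1].
- by exists (tcost e).+1; [apply: ExecSetT|rewrite muln1].
- by eexists; [apply: ExecSetIArr|rewrite muln1].
- by eexists; [apply: ExecSetTArr|rewrite muln1].
- case/andP: ok => ok1 ok2; move: n0w; rewrite mem_cat negb_or => /andP[w1 w2].
  have [t1 ex1 t1_le] := IH1 s ok1 w1 n0.
  have n_eq : ivar (feval c1 s) 0 = ivar s 0 by have [->] := feval_unchanged c1 s.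
  have [t2 ex2 t2_le] := IH2 (feval c1 s) ok2 w2 (etrans (congr1 _ n_eq) n0).
  exists (t1 + t2)%N; first exact: ExecSeq ex1 ex2.
  rewrite n_eq in t2_le; rewrite /= mulnDl; apply: leq_add.
    by apply: leq_trans t1_le _; rewrite leq_mul2l leq_pexp2l ?leq_maxl ?orbT.
  by apply: leq_trans t2_le _; rewrite leq_mul2l leq_pexp2l ?leq_maxr ?orbT.
- case/andP: ok => ok1 ok2; move: n0w; rewrite mem_cat negb_or => /andP[w1 w2].
  have [t1 ex1 t1_le] := IH1 s ok1 w1 n0.
  have [t2 ex2 t2_le] := IH2 s ok2 w2 n0.
  set m := maxn (nesting c1) (nesting c2); set n := ivar s 0.
  have nm : (0 < n ^ m)%N by rewrite expn_gt0 n0.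
  have le1 : (t1 <= weight c1 * n ^ m)%N.
    by apply: leq_trans t1_le _; rewrite leq_mul2l leq_pexp2l ?leq_maxl ?orbT.
  have le2 : (t2 <= weight c2 * n ^ m)%N.
    by apply: leq_trans t2_le _; rewrite leq_mul2l leq_pexp2l ?leq_maxr ?orbT.
  have leb : (bcost b <= bcost b * n ^ m)%N by apply: leq_pmulr.
  have [bT|bF] := boolP (beval s b).
    exists (bcost b + t1).+1; first by rewrite /= bT; apply: ExecIfTrue.
    by rewrite /= -/m -/n mulSn !mulnDl; lia.
  exists (bcost b + t2).+1; first by rewrite /= (negbTE bF); apply: ExecIfFalse.
  by rewrite /= -/m -/n mulSn !mulnDl; lia.
- have ok' := ok; case/and3P: ok => okc vc _.
  have w : 0%N \notin written 0 c.
    by move: n0w; rewrite /= inE negb_or => /andP[].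
  have [|t ex_t t_le] := @exec_for c v s (weight c * ivar s 0 ^ nesting c) ok'.
    move=> s1 s1n; have [|t ext tle] := IH s1 okc w; first by rewrite s1n.
    by exists t => //; rewrite -s1n.
  exists t => //; apply: leq_trans t_le _; set n := ivar s 0.
  have nm : (0 < n ^ nesting c)%N by rewrite expn_gt0 n0.
  rewrite [nesting _]/= [weight _]/= expnS mulnA.
  have : (n * 16 <= n * 16 * n ^ nesting c)%N by apply: leq_pmulr.
  rewrite -/n in n0; set N := (n ^ _)%N in nm *.
  have -> : ((weight c + 16) * n * N = n * (weight c * N) + n * 16 * N)%N.
    by rewrite [((_ + _) * n)%N]mulnC mulnDr !mulnDl !mulnA.
  by rewrite mulnDr; set X := (n * (_ * _))%N; lia.
Qed.

End ForPrograms.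

(** * Walk weights, cycle mean and potentials: programs *)

(** Memory layout: the arrays hold the matrix [A], the walk weights [D], the
    potentials [P], the zero arcs [Z], the reachability relation [R], the labels
    [L] and the chosen successors [S].  The integer variables 1, 2 and 3 are
    loop indices, 4 and 5 hold a pair of nodes whose labels are to be merged, 6
    and 7 these labels, 8 the result; the max-plus variables 2 and 4 hold the
    cycle mean [l] and its multiples [k * l], 1 and 3 a running maximum and
    minimum. *)
Local Notation arrA u v := (TArr 0 u v).
Local Notation arrD k v := (TArr 1 k v).
Local Notation arrP v := (TArr 2 v (IConst 0)).
Local Notation arrZ u v := (IArr 0 u v).
Local Notation arrR u v := (IArr 1 u v).
Local Notation arrL v := (IArr 2 v (IConst 0)).
Local Notation arrS v := (IArr 3 v (IConst 0)).

Definition walk_init : prog := PFor 1 (PSetTArr 1 (IConst 0) (IVar 1) TZero).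

Definition walk_sum : prog :=
  PFor 3 (PSetT 1 (TMax (TVar 1)
                     (TAdd (arrD (IVar 1) (IVar 3)) (arrA (IVar 3) (IVar 2))))).

Definition walk_cell : prog :=
  PSeq (PSetT 1 TNinfty)
    (PSeq walk_sum (PSetTArr 1 (IAdd (IVar 1) (IConst 1)) (IVar 2) (TVar 1))).

Definition walk_table : prog :=
  PSeq walk_init (PFor 1 (PFor 2 walk_cell)).

Definition ratio_exp (k : iexp) : texp :=
  TDiv (TSub (arrD (IVar 0) (IVar 1)) (arrD k (IVar 1))) (ISub (IVar 0) k).

Definition min_ratio_step : prog :=
  PIf (BLeT (ratio_exp (IVar 2)) (TVar 3)) (PSetT 3 (ratio_exp (IVar 2))) PSkip.

Definition min_ratio : prog :=
  PSeq (PSetT 3 (ratio_exp (IConst 0))) (PFor 2 min_ratio_step).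

Definition cycle_mean_step : prog :=
  PSeq min_ratio (PSetT 2 (TMax (TVar 2) (TVar 3))).

Definition cycle_mean : prog :=
  PSeq (PSetT 2 TNinfty) (PFor 1 cycle_mean_step).

Definition potential_step : prog :=
  PFor 2 (PSetTArr 2 (IVar 2) (IConst 0)
            (TMax (arrP (IVar 2)) (TSub (arrD (IVar 1) (IVar 2)) (TVar 4)))).

Definition potential_round : prog :=
  PSeq potential_step (PSetT 4 (TAdd (TVar 4) (TVar 2))).

Definition potentials : prog :=
  PSeq (PSetT 4 TZero) (PFor 1 potential_round).

Section WalkSpecs.
Variable R : realType.
Implicit Types (s : state R) (D a : nat -> nat -> maxplus R).

(** [D k v] is the maximal weight of the walks of length [k] ending in [v]. *)
Definition is_walk_table n a D : Prop :=
  (forall v, (v < n)%N -> D 0%N v = 1) /\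
  (forall k v, (k < n)%N -> (v < n)%N ->
     D k.+1 v = \sum_(0 <= u < n) D k u * a u v).

Lemma walk_sum_spec s : tvar s 1 = 0 ->
  tvar (feval walk_sum s) 1 =
  \sum_(0 <= u < ivar s 0) tarr s 1 (ivar s 1) u * tarr s 0 u (ivar s 2).
Proof.
move=> t0; pose I k s' := tvar s' 1 =
  \sum_(0 <= u < k) tarr s 1 (ivar s 1) u * tarr s 0 u (ivar s 2).
apply: (@for_ind R I); first by rewrite /I big_geq.
move=> k s' _ [ui _ _ uA] s'k; rewrite /I big_nat_recr //= => <-.
by rewrite /upd1 /= s'k (ui 1%N isT) (ui 2%N isT) (uA 1%N isT) (uA 0%N isT).
Qed.

Lemma walk_cell_spec s i j :
  tarr (feval walk_cell s) 1 i j =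
  if (i == (ivar s 1).+1) && (j == ivar s 2) then
    \sum_(0 <= u < ivar s 0) tarr s 1 (ivar s 1) u * tarr s 0 u (ivar s 2)
  else tarr s 1 i j.
Proof.
have := @walk_sum_spec (set_tvar s 1 0) erefl.
have := feval_unchanged walk_sum (set_tvar s 1 0).
rewrite -[feval walk_cell s]/(feval (PSetTArr 1 (IAdd (IVar 1) (IConst 1))
  (IVar 2) (TVar 1)) (feval walk_sum (set_tvar s 1 0))).
set s2 := feval walk_sum _ => -[ui _ _ uA] /= ->.
by rewrite /upd3 /= (ui 1%N isT) (ui 2%N isT) addn1 (uA 1%N isT).
Qed.

Lemma walk_init_spec s v : (v < ivar s 0)%N ->
  tarr (feval walk_init s) 1 0%N v = 1.
Proof.
pose I k s' := forall v, (v < k)%N -> tarr s' 1 0%N v = 1 :> maxplus R.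
have : I (ivar s 0) (feval walk_init s); last by apply.
apply: (@for_ind R I) => // k s' _ _ s'k IH {}v; rewrite ltnS /= /upd3 /= s'k.
by case: eqP => [->|/eqP nk] //= vk; apply: IH; rewrite ltn_neqAle nk.
Qed.

Lemma walk_table_spec s :
  is_walk_table (ivar s 0) (tarr s 0) (tarr (feval walk_table s) 1).
Proof.
set s1 := feval walk_init s.
have [u1i _ _ u1A] : unchanged walk_init s s1 := feval_unchanged _ _.
rewrite -(u1i 0%N isT) -(u1A 0%N isT).
change (feval walk_table s) with (feval (PFor 1 (PFor 2 walk_cell)) s1).
set n := ivar s1 0; set a := tarr s1 0.
pose rec D k v := D k.+1 v = \sum_(0 <= u < n) D k u * a u v.
pose I k s' := (forall v, (v < n)%N -> tarr s' 1 0%N v = 1) /\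
  (forall k' v, (k' < k)%N -> (v < n)%N -> rec (tarr s' 1) k' v).
apply: (@for_ind R I).
  by split=> // v vn; rewrite /=; apply: walk_init_spec; rewrite -(u1i 0%N isT).
move=> k s' kn [ui _ _ uA] s'k [I0 IS].
pose J j s'' := (forall i v, i != k.+1 -> tarr s'' 1 i v = tarr s' 1 i v) /\
  (forall v, (v < j)%N -> rec (tarr s'' 1) k v).
have s'n : ivar s' 0 = n by apply: ui.
have : J (ivar s' 0) (feval (PFor 2 walk_cell) s').
  apply: (@for_ind R J) => // j s2 jn [u2i _ _ u2A] s2j [J0 JS].
  have s2k : ivar s2 1 = k by rewrite (u2i 1%N isT).
  have s2n : ivar s2 0 = n by rewrite (u2i 0%N isT).
  have s2a : tarr s2 0 = a by rewrite (u2A 0%N isT) (uA 0%N isT).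
  have cell i v := walk_cell_spec s2 i v; rewrite s2k s2n s2a s2j in cell.
  move: (feval walk_cell s2) cell => s3 cell.
  have row i : i != k.+1 -> tarr s3 1 i =1 tarr s2 1 i.
    by move=> ik v; rewrite cell (negbTE ik).
  split=> [i v ik|v vj] /=; first by rewrite row // J0.
  rewrite /rec /=; under eq_bigr do rewrite row ?neq_ltn ?leqnn //.
  rewrite cell eqxx /=; case: eqP => [-> //|/eqP nj].
  by apply: JS; rewrite ltn_neqAle nj -ltnS.
rewrite s'n => -[J0 JS]; split=> [v vn|k' v k'k vn] /=; first by rewrite J0 ?I0.
move: k'k; rewrite ltnS leq_eqVlt => /predU1P[->|k'k]; first exact: JS.
rewrite /rec /= J0 ?eqSS ?ltn_eqF // IS //; apply: eq_bigr => u _.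
by rewrite J0 // neq_ltn ltnS ltnW.
Qed.

Definition mean_ratio n D v k : maxplus R :=
  maxplus_divn (maxplus_sub (D n v) (D k v)) (n - k).

Lemma min_ratio_spec s : (0 < ivar s 0)%N ->
  let r := mean_ratio (ivar s 0) (tarr s 1) (ivar s 1) in
  let m := tvar (feval min_ratio s) 3 in
  (exists2 k, (k < ivar s 0)%N & m = r k) /\
  (forall k, (k < ivar s 0)%N -> m <=t r k).
Proof.
move=> n0 r m; set n := ivar s 0 in r n0 *.
pose s1 := set_tvar s 3 (r 0%N).
pose I k s' := (exists2 k', (k' < n)%N & tvar s' 3 = r k') /\
   (forall k', (k' < k)%N -> tvar s' 3 <=t r k').
change (I (ivar s1 0) (feval (PFor 2 min_ratio_step) s1)).
apply: for_ind; first by split=> //; exists 0%N.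
move=> k s2 kn [ui _ _ uA] s2k [[k0 k0n mE] m_le].
have rE : teval s2 (ratio_exp (IVar 2)) = r k.
  by rewrite /= s2k (uA 1%N isT) (ui 1%N isT) (ui 0%N isT).
have -> : feval min_ratio_step s2 =
    if r k <=t tvar s2 3 then set_tvar s2 3 (r k) else s2 by rewrite -rE.
case: ifP.
  move=> le_m; split; first by exists k.
  move=> k'; rewrite ltnS leq_eqVlt => /predU1P[->|k'k] /=.
    exact: mple_refl.
  by apply: mple_trans le_m _; apply: m_le.
move=> gt_m; split; first by exists k0.
move=> k'; rewrite ltnS leq_eqVlt => /predU1P[->|k'k] /=; last exact: m_le.
by have := mple_total (r k) (tvar s2 3); rewrite gt_m.
Qed.

(** Karp's formula for the maximal mean weight of a cycle, which is -oo if
    there is no cycle. *)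
Definition is_cycle_mean n D (lam : maxplus R) : Prop :=
  (forall v, (v < n)%N -> exists2 k, (k < n)%N & mean_ratio n D v k <=t lam) /\
  (lam = 0 \/
   exists2 v, (v < n)%N & forall k, (k < n)%N -> lam <=t mean_ratio n D v k).

Lemma cycle_mean_spec s : (0 < ivar s 0)%N ->
  is_cycle_mean (ivar s 0) (tarr s 1) (tvar (feval cycle_mean s) 2).
Proof.
move=> n0; set n := ivar s 0; set D := tarr s 1.
pose I j s' := (forall v, (v < j)%N -> exists2 k, (k < n)%N &
    mean_ratio n D v k <=t tvar s' 2) /\
  (tvar s' 2 = 0 \/
   exists2 v, (v < n)%N &
     forall k, (k < n)%N -> tvar s' 2 <=t mean_ratio n D v k).
pose s0 := set_tvar s 2 0.
change (I (ivar s0 0) (feval (PFor 1 cycle_mean_step) s0)).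
apply: for_ind; first by split=> //; left.
move=> j s1 jn [ui _ ut uA] s1j [I1 I2].
have s1n : ivar s1 0 = n by rewrite (ui 0%N isT).
have s1D : tarr s1 1 = D by rewrite (uA 1%N isT).
have := @min_ratio_spec s1; rewrite s1n s1D s1j => /(_ n0).
have := feval_unchanged min_ratio s1.
rewrite -[feval cycle_mean_step s1]/(feval (PSetT 2 (TMax (TVar 2) (TVar 3)))
  (feval min_ratio s1)).
set s2 := feval min_ratio s1 => -[_ _ u2t _] [[k0 k0n mE] m_le].
have lamE : tvar (set_ivar (feval (PSetT 2 (TMax (TVar 2) (TVar 3))) s2) 1 j.+1) 2
    = tvar s1 2 + tvar s2 3 by rewrite /= /upd1 /= (u2t 2%N isT).
rewrite /I lamE; split.
  move=> v; rewrite ltnS leq_eqVlt => /predU1P[->|vj].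
    by exists k0 => //; rewrite -mE mp_add_right.
  have [k kn le_k] := I1 v vj; exists k => //.
  exact: mple_trans le_k (mp_add_left _ _).
have [->|->] := mp_add_cases (tvar s1 2) (tvar s2 3); first exact: I2.
by right; exists j.
Qed.

Lemma potential_step_spec s v j :
  tarr (feval potential_step s) 2 v j =
  if (v < ivar s 0)%N && (j == 0%N) then
    tarr s 2 v 0%N + maxplus_sub (tarr s 1 (ivar s 1) v) (tvar s 4)
  else tarr s 2 v j.
Proof.
pose I k s' := forall v j, tarr s' 2 v j =
  if (v < k)%N && (j == 0%N) then
    tarr s 2 v 0%N + maxplus_sub (tarr s 1 (ivar s 1) v) (tvar s 4)
  else tarr s 2 v j.
move: v j; apply: (@for_ind R I) => // k s1 kn [ui _ ut uA] s1k IH v j.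
rewrite /= /upd3 /= s1k (ui 1%N isT) (ut 4%N isT) (uA 1%N isT) !IH ltnn ltnS.
case: (ltngtP v k) => //= ->.
by case: eqP => // ->.
Qed.

Lemma potentials_spec s (l : R) : tvar s 2 = Fin l ->
  (forall v, tarr s 2 v 0%N = 0) ->
  forall v, (v < ivar s 0)%N ->
  tarr (feval potentials s) 2 v 0%N =
  \sum_(0 <= k < ivar s 0) maxplus_sub (tarr s 1 k v) (Fin (k%:R * l)).
Proof.
move=> lamE P0; set n := ivar s 0.
pose I k s' := tvar s' 4 = Fin (k%:R * l) /\ forall v, (v < n)%N ->
  tarr s' 2 v 0%N =
  \sum_(0 <= k' < k) maxplus_sub (tarr s 1 k' v) (Fin (k'%:R * l)).
suff [] : I n (feval potentials s) by [].
pose s0 := set_tvar s 4 1.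
change (I (ivar s0 0) (feval (PFor 1 potential_round) s0)).
apply: for_ind.
  by split=> [|v vn]; [rewrite /= /upd1 /= mul0r|rewrite big_geq //=; apply: P0].
move=> k s1 kn [ui _ ut uA] s1k [I1 I2].
have s1n : ivar s1 0 = n by rewrite (ui 0%N isT).
have := feval_unchanged potential_step s1.
have := potential_step_spec s1.
rewrite -[feval potential_round s1]/(feval (PSetT 4 (TAdd (TVar 4) (TVar 2)))
  (feval potential_step s1)).
move: (feval potential_step s1) => s2 step [_ _ u2t _]; split.
  rewrite /= /upd1 /= (u2t 4%N isT) (u2t 2%N isT) I1 (ut 2%N isT) /= /upd1 /= lamE.
  by congr Fin; rewrite -natr1 mulrDl mul1r.
move=> v vn; rewrite /= step s1n vn eqxx /= big_nat_recr //= I2 //.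
by rewrite s1k I1 (uA 1%N isT).
Qed.

End WalkSpecs.

(** * The critical graph and its classes: programs *)

Definition arc_cell : prog :=
  PIf (BLeT (TAdd (TVar 2) (arrP (IVar 2)))
            (TAdd (arrP (IVar 1)) (arrA (IVar 1) (IVar 2))))
    (PSeq (PSetIArr 0 (IVar 1) (IVar 2) (IConst 1))
          (PSetIArr 1 (IVar 1) (IVar 2) (IConst 1)))
    PSkip.

Definition arcs : prog := PFor 1 (PFor 2 arc_cell).

Definition closure_cell : prog :=
  PIf (BAnd (BLeI (IConst 1) (arrR (IVar 2) (IVar 1)))
            (BLeI (IConst 1) (arrR (IVar 1) (IVar 3))))
    (PSetIArr 1 (IVar 2) (IVar 3) (IConst 1)) PSkip.

Definition closure_round : prog := PFor 2 (PFor 3 closure_cell).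

Definition transitive_closure : prog := PFor 1 closure_round.

Definition critical_exp (u v : iexp) : bexp :=
  BAnd (BLeI (IConst 1) (arrZ u v)) (BLeI (IConst 1) (arrR v u)).

Definition eq_exp (e1 e2 : iexp) : bexp := BAnd (BLeI e1 e2) (BLeI e2 e1).

Definition successor_cell : prog :=
  PIf (critical_exp (IVar 1) (IVar 2))
    (PSetIArr 3 (IVar 1) (IConst 0) (IVar 2)) PSkip.

Definition successors : prog := PFor 1 (PFor 2 successor_cell).

Definition init_labels : prog :=
  PFor 1 (PSetIArr 2 (IVar 1) (IConst 0) (IVar 1)).

Definition scan_cell : prog :=
  PIf (BAnd (critical_exp (IVar 2) (IVar 3))
            (BNot (eq_exp (arrL (IVar 3)) (arrL (arrS (arrL (IVar 2)))))))
    (PSeq (PSetI 4 (IVar 3)) (PSetI 5 (arrS (arrL (IVar 2))))) PSkip.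

Definition scan : prog :=
  PSeq (PSetI 4 (IConst 0))
    (PSeq (PSetI 5 (IConst 0)) (PFor 2 (PFor 3 scan_cell))).

Definition relabel_cell : prog :=
  PIf (eq_exp (arrL (IVar 2)) (IVar 7))
    (PSetIArr 2 (IVar 2) (IConst 0) (IVar 6)) PSkip.

Definition relabel : prog :=
  PSeq (PSetI 6 (arrL (IVar 4)))
    (PSeq (PSetI 7 (arrL (IVar 5))) (PFor 2 relabel_cell)).

Definition merge_pass : prog := PSeq scan relabel.

Definition merge_labels : prog := PFor 1 merge_pass.

Definition count_cell : prog :=
  PIf (BAnd (BLeI (IConst 1) (arrR (IVar 1) (IVar 1)))
            (eq_exp (arrL (IVar 1)) (IVar 1)))
    (PSetI 8 (IAdd (IVar 8) (IConst 1))) PSkip.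

Definition count_labels : prog :=
  PSeq (PSetI 8 (IConst 0)) (PFor 1 count_cell).

(** The cells that a double loop has treated when it reaches [(i, j)]. *)
Definition done_before i j a b : bool := (a < i)%N || (a == i) && (b < j)%N.

Lemma done_beforeS i j a b :
  done_before i j.+1 a b = done_before i j a b || (a == i) && (b == j).
Proof.
by rewrite /done_before; lia.
Qed.

Lemma done_before_row n i a b : (b < n)%N ->
  done_before i n a b = done_before i.+1 0 a b.
Proof. by rewrite /done_before ltnS leq_eqVlt ltn0 andbF orbF => ->; lia. Qed.

Lemma done_before_all n a b : (a < n)%N -> done_before n 0 a b.
Proof. by rewrite /done_before => ->. Qed.

Section GraphSpecs.
Variable R : realType.
Implicit Types (s : state R).

(** [J i j] describes the state in which the cells before [(i, j)] have been
    treated. *)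
Lemma for_ind2 (J : nat -> nat -> state R -> Prop) u v c s :
  u \notin written 0 (PFor v c) -> 0%N \notin written 0 (PFor u (PFor v c)) ->
  (forall i j s' w x, w \in [:: u; v] -> J i j s' -> J i j (set_ivar s' w x)) ->
  (forall i s', J i (ivar s 0) s' -> J i.+1 0%N s') ->
  J 0%N 0%N s ->
  (forall i j s', (i < ivar s 0)%N -> (j < ivar s 0)%N ->
     unchanged (PFor u (PFor v c)) s s' -> ivar s' u = i -> ivar s' v = j ->
     J i j s' -> J i j.+1 (feval c s')) ->
  J (ivar s 0) 0%N (feval (PFor u (PFor v c)) s).
Proof.
move=> u_w n_w stable row J0 step; set n := ivar s 0 in row step *.
have su i j s' x : J i j s' -> J i j (set_ivar s' u x).
  by apply: stable; rewrite mem_head.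
have sv i j s' x : J i j s' -> J i j (set_ivar s' v x).
  by apply: stable; rewrite inE mem_head orbT.
apply: (@for_ind R (fun i s' => J i 0%N s') u (PFor v c) s); first exact: su.
move=> i s1 ni un1 s1i J1.
have s1n : ivar s1 0 = n by case: un1 => ui _ _ _; apply: ui.
apply/su/row; rewrite -/n -s1n.
apply: (@for_ind R (fun j s' => J i j s') v c s1); first exact: sv.
move=> j s2 nj un2 s2j J2; apply/sv/step => //.
- by rewrite -s1n.
- apply: (unchanged_trans (fun _ _ => id) _ un1 un2) => k x xc.
  by rewrite [written _ _]/= mem_cat xc orbT.
- by case: un2 => ui _ _ _; rewrite ui.
Qed.

Definition zero_arc s u v : bool :=
  tvar s 2 * tarr s 2 v 0%N <=t tarr s 2 u 0%N * tarr s 0 u v.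

Lemma arcs_spec s :
  (forall u v, iarr s 0 u v = 0%N) -> (forall u v, iarr s 1 u v = 0%N) ->
  forall u v, (u < ivar s 0)%N -> (v < ivar s 0)%N ->
  (0 < iarr (feval arcs s) 0 u v)%N = zero_arc s u v /\
  (0 < iarr (feval arcs s) 1 u v)%N = zero_arc s u v.
Proof.
move=> Z0 R0; set n := ivar s 0.
pose J i j s' := forall u v, (v < n)%N ->
  (0 < iarr s' 0 u v)%N = done_before i j u v && zero_arc s u v /\
  (0 < iarr s' 1 u v)%N = done_before i j u v && zero_arc s u v.
have : J n 0%N (feval arcs s).
  apply: for_ind2 => //.
  - by move=> i s' Ji u v vn; rewrite -(done_before_row _ _ vn); apply: Ji.
  - by move=> u v vn; rewrite Z0 R0 /done_before ltn0 andbF.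
  move=> i j s' ni nj [ui uia ut uA] s'i s'j Jij u v vn.
  have -> : feval arc_cell s' = if zero_arc s i j then
      set_iarr (set_iarr s' 0 i j 1) 1 i j 1 else s'.
    by rewrite /= s'i s'j (uA 2%N isT) (uA 0%N isT) (ut 2%N isT).
  have [J0 J1] := Jij u v vn.
  have J10 a : (0 < iarr s' 1 a v)%N = (0 < iarr s' 0 a v)%N.
    by have [-> ->] := Jij a v vn.
  rewrite done_beforeS andb_orl -J0; have [arc_ij|narc_ij] := ifP.
    rewrite /= /upd3 /=; case: eqP => [->|_] /=; last by rewrite orbF J10.
    by case: eqP => [->|_] /=; rewrite ?arc_ij ?orbT ?orbF ?J10.
  rewrite J10; case: eqP => [->|_] /=; last by rewrite orbF.
  by case: eqP => [->|_] /=; rewrite ?narc_ij ?orbF.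
move=> Jn u v un vn; have := Jn u v vn; by rewrite done_before_all.
Qed.

Definition linked s u v : bool := (0 < iarr s 1 u v)%N.

Lemma closure_round_spec s u v :
  (ivar s 1 < ivar s 0)%N -> (v < ivar s 0)%N -> (u < ivar s 0)%N ->
  linked (feval closure_round s) u v =
  linked s u v || linked s u (ivar s 1) && linked s (ivar s 1) v.
Proof.
set n := ivar s 0; set k := ivar s 1 => kn.
pose J i j s' := forall u v, (v < n)%N ->
  linked s' u v = linked s u v ||
    done_before i j u v && (linked s u k && linked s k v).
move=> vn un; have : J n 0%N (feval closure_round s); last first.
  by move=> ->; rewrite // done_before_all.
apply: for_ind2 => //.
- by move=> i s' Ji {un vn}u {}v vn; rewrite -(done_before_row _ _ vn); apply: Ji.
- by move=> {un vn}u {}v vn; rewrite /done_before ltn0 andbF /= orbF.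
move=> i j s' ni nj [ui _ _ _] s'i s'j Jij {un vn}u {}v vn.
have s'k : ivar s' 1 = k by apply: ui.
have -> : feval closure_cell s' = if linked s' i k && linked s' k j then
    set_iarr s' 1 i j 1 else s' by rewrite /= s'i s'j s'k.
rewrite done_beforeS andb_orl orbA -Jij //.
(* the row and the column of [k] are not modified in round [k] *)
have -> : linked s' k j = linked s k j.
  rewrite Jij //; case: (linked s k j); first by [].
  by rewrite !andbF.
have -> : linked s' i k = linked s i k.
  by rewrite Jij //; case: (linked s i k); rewrite ?andbF.
case: ifP => [/andP[ik kj]|]; last first.
  case: eqP => [->|_] /=; last by rewrite orbF.
  by case: eqP => [->|_] /= => [->|_]; rewrite ?orbF.
rewrite {1}/linked /= /upd3 /=; case: eqP => [->|_] /=; last by rewrite orbF.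
by case: eqP => [->|_] /=; rewrite ?ik ?kj ?orbT ?orbF.
Qed.

(** After round [k], the relation is transitive through the nodes up to [k].
    Quantifying over all transitive relations states minimality without a
    notion of path. *)
Lemma transitive_closure_spec s :
  let n := ivar s 0 in let s' := feval transitive_closure s in
  [/\ forall u v, (u < n)%N -> (v < n)%N -> linked s u v -> linked s' u v,
      forall u w v, (u < n)%N -> (w < n)%N -> (v < n)%N ->
        linked s' u w -> linked s' w v -> linked s' u v &
      forall S : nat -> nat -> Prop,
        (forall u v, (u < n)%N -> (v < n)%N -> linked s u v -> S u v) ->
        (forall u w v, (u < n)%N -> (w < n)%N -> (v < n)%N ->
           S u w -> S w v -> S u v) ->
        forall u v, (u < n)%N -> (v < n)%N -> linked s' u v -> S u v].
Proof.
move=> n s'.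
pose I k s' :=
  [/\ forall u v, (u < n)%N -> (v < n)%N -> linked s u v -> linked s' u v,
      forall u w v, (u < n)%N -> (w < k)%N -> (v < n)%N ->
        linked s' u w -> linked s' w v -> linked s' u v &
      forall S : nat -> nat -> Prop,
        (forall u v, (u < n)%N -> (v < n)%N -> linked s u v -> S u v) ->
        (forall u w v, (u < n)%N -> (w < n)%N -> (v < n)%N ->
           S u w -> S w v -> S u v) ->
        forall u v, (u < n)%N -> (v < n)%N -> linked s' u v -> S u v].
have : I n s'; last by [].
apply: (@for_ind R I); first by split=> // S S1 _ u v; apply: S1.
move=> k s1 kn [ui _ _ _] s1k [I1 I2 I3].
have s1n : ivar s1 0 = n by apply: ui.
have round u v : (u < n)%N -> (v < n)%N ->
    linked (feval closure_round s1) u v =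
    linked s1 u v || linked s1 u k && linked s1 k v.
  by move=> un vn; rewrite closure_round_spec ?s1k ?s1n.
move: (feval _ s1) round => s2 round; split.
- move=> u v un vn /(I1 _ _ un vn) uv.
  by change (linked s2 u v); rewrite round // uv.
- move=> u w v un wk vn; have wn : (w < n)%N by apply: leq_trans wk kn.
  change (linked s2 u w -> linked s2 w v -> linked s2 u v).
  rewrite !round //; move: wk; rewrite ltnS leq_eqVlt.
  case/predU1P => [->|wk].
    by case: (linked s1 u k); case: (linked s1 k v); rewrite /= ?andbF ?orbT.
  have t a b : (a < n)%N -> (b < n)%N ->
      linked s1 a w -> linked s1 w b -> linked s1 a b.
    by move=> *; apply: (I2 a w b).
  case/orP => [uw|/andP[uk kw]]; case/orP => [wv|/andP[wk' kv]].
  + by rewrite (t u v).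
  + by rewrite (t u k) // kv orbT.
  + by rewrite uk (t k v) ?orbT.
  + by rewrite uk kv orbT.
- move=> S S1 S2 u v un vn; change (linked s2 u v -> S u v); rewrite round //.
  case/orP => [|/andP[uk kv]]; first exact: (I3 S S1 S2).
  by apply: (S2 u k v) => //; apply: (I3 S S1 S2).
Qed.

Definition crit s u v : bool := (0 < iarr s 0 u v)%N && (0 < iarr s 1 v u)%N.

Lemma successors_spec s : (0 < ivar s 0)%N -> (forall v, iarr s 3 v 0%N = 0%N) ->
  let succ v := iarr (feval successors s) 3 v 0%N in
  (forall u, (succ u < ivar s 0)%N) /\
  (forall u v, (u < ivar s 0)%N -> (v < ivar s 0)%N -> crit s u v ->
     crit s u (succ u)).
Proof.
move=> n0 S0; set n := ivar s 0.
pose J i j s' := (forall u, (iarr s' 3 u 0%N < n)%N) /\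
  (forall u v, (v < n)%N -> done_before i j u v -> crit s u v ->
     crit s u (iarr s' 3 u 0%N)).
have : J n 0%N (feval successors s); last first.
  move=> [J1 J2]; split=> // u v un vn; apply: J2 => //.
  exact: done_before_all.
apply: for_ind2 => //.
- move=> i s' [J1 J2]; split=> // u v vn; rewrite -(done_before_row _ _ vn).
  exact: J2.
- by split=> [u|u v vn]; rewrite ?S0 // /done_before ltn0 andbF.
move=> i j s' ni nj [_ uia _ _] s'i s'j [J1 J2].
have -> : feval successor_cell s' = if crit s i j then
    set_iarr s' 3 i 0 j else s'.
  by rewrite /= s'i s'j (uia 0%N isT) (uia 1%N isT).
split=> [u|u v vn].
  by case: ifP => // _; rewrite /= /upd3 /=; case: ifP.
rewrite done_beforeS => /orP[uv|/andP[/eqP-> /eqP->]] crit_uv; last first.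
  by rewrite crit_uv /= /upd3 /= eqxx.
case: ifP => [crit_ij|_]; last exact: (J2 u v).
rewrite /= /upd3 /= andbT; case: eqP => [-> //|_].
exact: (J2 u v).
Qed.

Lemma init_labels_spec s v : (v < ivar s 0)%N ->
  iarr (feval init_labels s) 2 v 0%N = v.
Proof.
pose I k s' := forall v, (v < k)%N -> iarr s' 2 v 0%N = v.
have : I (ivar s 0) (feval init_labels s); last by apply.
apply: (@for_ind R I) => // k s' _ _ s'k IH {}v; rewrite ltnS /= /upd3 /= s'k.
by case: eqP => [->|/eqP nk] //= vk; apply: IH; rewrite ltn_neqAle nk.
Qed.

Definition label s v : nat := iarr s 2 v 0%N.
Definition succ_of s v : nat := iarr s 3 v 0%N.

(** The successor of the label of [u] stands for the successors of all the
    nodes with this label, so that one comparison per arc suffices. *)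
Definition conflict s u v : bool :=
  crit s u v && (label s v != label s (succ_of s (label s u))).

Lemma scan_spec s :
  let n := ivar s 0 in let s' := feval scan s in
  (exists u v, [/\ (u < n)%N, (v < n)%N, conflict s u v, ivar s' 4 = v &
     ivar s' 5 = succ_of s (label s u)]) \/
  [/\ ivar s' 4 = 0%N, ivar s' 5 = 0%N &
     forall u v, (u < n)%N -> (v < n)%N -> ~~ conflict s u v].
Proof.
move=> n; pose s1 := set_ivar (set_ivar s 4 0) 5 0.
change (feval scan s) with (feval (PFor 2 (PFor 3 scan_cell)) s1).
pose J i j s' := (exists u v, [/\ (u < n)%N, (v < n)%N, conflict s u v,
    ivar s' 4 = v & ivar s' 5 = succ_of s (label s u)]) \/
  [/\ ivar s' 4 = 0%N, ivar s' 5 = 0%N &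
     forall u v, (v < n)%N -> done_before i j u v -> ~~ conflict s u v].
have : J n 0%N (feval (PFor 2 (PFor 3 scan_cell)) s1); last first.
  move=> Jn s'; case: Jn => [|[x0 y0 none]]; [by left|right; split=> //].
  by move=> u v un vn; apply: none; rewrite ?done_before_all.
apply: (@for_ind2 J 2 3 scan_cell s1) => //.
- by move=> i j s' w x; rewrite !inE => /orP[/eqP->|/eqP->].
- move=> i s' [|[x0 y0 none]]; [by left|right; split=> // u v vn].
  by rewrite -(done_before_row _ _ vn); apply: none.
- by right; split=> // u v vn; rewrite /done_before ltn0 andbF.
move=> i j s' ni nj [_ uia _ _] s'i s'j Jij.
have -> : feval scan_cell s' = if conflict s i j then
    set_ivar (set_ivar s' 4 j) 5 (succ_of s (label s i)) else s'.
  rewrite /= s'i s'j (uia 0%N isT) (uia 1%N isT) (uia 2%N isT) (uia 3%N isT).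
  by rewrite /conflict /crit -eqn_leq /upd1 /= ?s'i ?(uia 2%N isT) ?(uia 3%N isT).
have [cij|ncij] := boolP (conflict s i j); first by left; exists i, j.
case: Jij => [|[x0 y0 none]]; [by left|right; split=> // u v vn].
rewrite done_beforeS => /orP[uv|/andP[/eqP-> /eqP->]] //.
exact: none.
Qed.

Lemma relabel_spec s v : (v < ivar s 0)%N ->
  label (feval relabel s) v =
  if label s v == label s (ivar s 5) then label s (ivar s 4) else label s v.
Proof.
set n := ivar s 0; set p := label s (ivar s 4); set q := label s (ivar s 5).
move=> vn; pose s1 := set_ivar (set_ivar s 6 p) 7 q.
pose I k s' := forall v, label s' v =
  if (v < k)%N && (label s v == q) then p else label s v.
have : I n (feval relabel s); last by move=> ->; rewrite vn.
change (I (ivar s1 0) (feval (PFor 2 relabel_cell) s1)).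
apply: for_ind => // k s' kn [ui _ _ _] s'k IH {vn}v.
have -> : feval relabel_cell s' = if label s' k == q then
    set_iarr s' 2 k 0 p else s'.
  by rewrite /= -eqn_leq s'k (ui 7%N isT) (ui 6%N isT).
rewrite IH ltnn /= ltnS leq_eqVlt.
case: ifP => kq; rewrite /label /= /upd3 /= ?andbT.
  case: (eqVneq v k) => [->|_] /=; first by rewrite -/(label s k) kq.
  exact: IH.
rewrite -/(label s' v) -/(label s v) IH.
by case: (eqVneq v k) => [->|_] //=; rewrite kq ltnn.
Qed.

Lemma count_labels_spec s :
  ivar (feval count_labels s) 8 =
  (\sum_(0 <= v < ivar s 0) (linked s v v && (label s v == v)))%N.
Proof.
pose I k s' := ivar s' 8 =
  (\sum_(0 <= v < k) (linked s v v && (label s v == v)))%N.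
change (I (ivar (set_ivar s 8 0) 0) (feval (PFor 1 count_cell) (set_ivar s 8 0))).
apply: for_ind; first by rewrite /I big_geq.
move=> k s' kn [_ uia _ _] s'k IH; rewrite /I big_nat_recr //= -IH.
rewrite s'k (uia 1%N isT) (uia 2%N isT) -eqn_leq.
by rewrite /linked /label /=; case: ifP => _; rewrite /= /upd1 ?addn0 ?addn1.
Qed.

End GraphSpecs.

(** * Merging labels *)

Section Merge.
Variables (n : nat) (E : nat -> nat -> Prop).
Implicit Types (L : nat -> nat).

(** The relation [E] stands for the cyclic classes, of which the merging loop
    only needs that it is an equivalence preserved by critical arcs. *)
Definition sound_labels L : Prop := forall v, (v < n)%N ->
  [/\ (L v < n)%N, L (L v) = L v & E v (L v)].

Definition label_count L : nat := \sum_(0 <= v < n) (L v == v).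

(** The nodes that carry their own number as label represent the labels, and
    [q] is the only one that a merge removes. *)
Lemma label_count_merge L L' p q :
  sound_labels L -> (p < n)%N -> (q < n)%N -> L p = p -> L q = q -> p != q ->
  (forall v, (v < n)%N -> L' v = if L v == q then p else L v) ->
  (label_count L').+1 = label_count L.
Proof.
move=> Lok pn qn Lp Lq pq L'E.
have one : (\sum_(0 <= v < n) (v == q) = 1)%N.
  rewrite big_mkord (bigD1 (Ordinal qn)) //= eqxx big1 ?addn0 // => v vq.
  by apply/eqP; rewrite eqb0; apply: contra vq => /eqP vq; apply/eqP/val_inj.
rewrite -addn1 -one /label_count -big_split /=.
apply: eq_big_nat => v /= vn; rewrite L'E //.
have [_ Lv _] := Lok v vn.
have [vq|vq] := eqVneq v q; first by rewrite vq Lq eqxx (negbTE pq).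
rewrite addn0; case: (eqVneq (L v) q) => // Lvq.
have -> : (p == v) = false.
  by apply/eqP => pv; move: Lvq; rewrite -pv Lp => /eqP; rewrite (negbTE pq).
by rewrite Lvq eq_sym (negbTE vq).
Qed.

Lemma sound_labels_merge L L' p q :
  (forall u v w, E u v -> E v w -> E u w) ->
  sound_labels L -> (p < n)%N -> L p = p -> p != q -> E q p ->
  (forall v, (v < n)%N -> L' v = if L v == q then p else L v) ->
  sound_labels L'.
Proof.
move=> E_trans Lok pn Lp pq Eqp L'E v vn.
have [Lvn LLv Ev] := Lok v vn; rewrite !(L'E v) //.
have [Lvq|Lvq] := eqVneq (L v) q.
  split=> //; last by apply: E_trans Eqp; rewrite -Lvq.
  by rewrite L'E // Lp (negbTE pq).
by split=> //; rewrite L'E // LLv (negbTE Lvq).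
Qed.

End Merge.

Section MergeProgram.
Variables (R : realType) (s : state R) (E : nat -> nat -> Prop).
Let n := ivar s 0.
Hypothesis n_gt0 : (0 < n)%N.
Hypothesis label0 : forall v, (v < n)%N -> label s v = v.
Hypothesis succ_lt : forall u, (succ_of s u < n)%N.
Hypothesis succ_crit : forall u v, (u < n)%N -> (v < n)%N ->
  crit s u v -> crit s u (succ_of s u).
Hypothesis E_refl : forall u, E u u.
Hypothesis E_sym : forall u v, E u v -> E v u.
Hypothesis E_trans : forall u v w, E u v -> E v w -> E u w.
Hypothesis E_succ : forall u v u' v',
  (u < n)%N -> (v < n)%N -> (u' < n)%N -> (v' < n)%N ->
  crit s u v -> crit s u' v' -> E u u' -> E v v'.
Hypothesis E_crit : forall u v u', (u < n)%N -> (v < n)%N -> (u' < n)%N ->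
  E u u' -> crit s u v -> exists2 v', (v' < n)%N & crit s u' v'.

Definition compatible (L : nat -> nat) : Prop :=
  forall u v, (u < n)%N -> (v < n)%N -> crit s u v ->
  L v = L (succ_of s (L u)).

(** Each pass either finds no conflict or lowers the number of labels, which
    starts at [n] and stays positive: [n] passes are enough. *)
Lemma merge_labels_spec :
  sound_labels n E (label (feval merge_labels s)) /\
  compatible (label (feval merge_labels s)).
Proof.
pose I k (s' : state R) := sound_labels n E (label s') /\
  (compatible (label s') \/ (label_count n (label s') + k <= n)%N).
have : I n (feval merge_labels s); last first.
  move=> [ok [//|]]; rewrite -[X in (_ <= X)%N]add0n leq_add2r leqn0 => /eqP cnt0.
  have [L0n LL0 _] := ok 0%N n_gt0.
  exfalso; move/eqP: cnt0; rewrite /label_count big_mkord sum_nat_eq0.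
  by move=> /forallP/(_ (Ordinal L0n)); rewrite /= LL0 eqxx.
apply: (@for_ind R I 1 merge_pass s).
  split.
    by move=> v vn; rewrite -![label (set_ivar _ _ _) _]/(label s _) !label0.
  right; rewrite addn0 /label_count.
  rewrite -[X in (_ <= X)%N]subn0 -[X in (_ <= X)%N]muln1.
  by rewrite -sum_nat_const_nat; apply: leq_sum => v _; apply: leq_b1.
move=> k s1 kn [ui uia _ _] s1k [ok bound].
have s1n : ivar s1 0 = n by apply: ui.
have critE u v : crit s1 u v = crit s u v.
  by rewrite /crit (uia 0%N isT) (uia 1%N isT).
have succE u : succ_of s1 u = succ_of s u by rewrite /succ_of (uia 3%N isT).
have := scan_spec s1; have [vi via _ _] := feval_unchanged scan s1.
have := @relabel_spec R (feval scan s1).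
rewrite (vi 0%N isT) s1n -[feval relabel _]/(feval merge_pass s1).
have lab_scan v : label (feval scan s1) v = label s1 v.
  by rewrite /label (via 2%N isT).
move: (feval merge_pass s1) => s3.
move: (feval scan s1) lab_scan {vi via} => s2 lab_scan relab scanP.
change (sound_labels n E (label s3) /\
  (compatible (label s3) \/ (label_count n (label s3) + k.+1 <= n)%N)).
have {}relab v : (v < n)%N -> label s3 v =
    if label s1 v == label s1 (ivar s2 5) then label s1 (ivar s2 4)
    else label s1 v by move=> vn; rewrite relab // !lab_scan.
move: scanP => [[u [v [un vn /andP[cuv luv] xE yE]]]|[x0 y0 none]].
  rewrite critE in cuv; rewrite xE yE succE in relab luv *.
  set y := succ_of s (label s1 u) in relab luv.
  have [Lun _ Eu] := ok u un; have [Lvn LLv Ev] := ok v vn.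
  have yn : (y < n)%N by apply: succ_lt.
  have [Lyn LLy Ey] := ok y yn.
  have [w wn cuw] := E_crit un vn Lun Eu cuv.
  have Evy : E v y by apply: (E_succ un vn Lun yn cuv (succ_crit Lun wn cuw) Eu).
  have Eqp : E (label s1 y) (label s1 v).
    by apply: E_trans Ev; apply: E_trans (E_sym Ey) (E_sym Evy).
  split; first exact: (sound_labels_merge E_trans ok Lvn LLv luv Eqp relab).
  right; rewrite addnS -addSn.
  rewrite (label_count_merge ok Lvn Lyn LLv LLy luv relab).
  by case: bound => // /(_ u v un vn cuv) /eqP; rewrite (negbTE luv).
rewrite x0 y0 in relab.
have same v : (v < n)%N -> label s3 v = label s1 v.
  by move=> vn; rewrite relab //; case: eqP.
split.
  move=> v vn; have [Lvn LLv Ev] := ok v vn.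
  by rewrite !same // ?same.
left=> u v un vn cuv; have [Lun _ _] := ok u un.
rewrite !same //; have := none u v un vn.
by rewrite /conflict critE cuv succE negbK => /eqP.
Qed.

End MergeProgram.

(** * Karp's formula *)

Lemma maxplus_subE (R : realType) (x : maxplus R) (c : R) :
  maxplus_sub x (Fin c) = x * Fin (- c).
Proof. by case: x. Qed.

Lemma mple_FinE (R : realType) (a b : R) : (Fin a <=t Fin b) = (a <= b).
Proof. by []. Qed.

Section Karp.
Variables (R : realType) (n : nat) (A : 'M[maxplus R]_n).
Variable D : nat -> nat -> maxplus R.
Hypothesis D0 : forall v : 'I_n, D 0 v = 1.
Hypothesis DS : forall k (v : 'I_n), (k < n)%N ->
  D k.+1 v = \sum_(u < n) D k u * A u v.

Lemma walk_table_pow k (v : 'I_n) :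
  (k <= n)%N -> D k v = \sum_(u < n) (A ^+ k) u v.
Proof.
elim: k v => [|k IH] v kn.
  rewrite D0; under eq_bigr do rewrite mx_pow0.
  rewrite (bigD1 v) //= eqxx big1 ?addr0 // => u /negbTE->.
  by [].
rewrite DS //; under eq_bigr => u _ do rewrite IH ?(ltnW kn) // mulr_suml.
rewrite exchange_big; apply: eq_bigr => u _.
by rewrite exprSr mxE.
Qed.

(** A walk of length [n] ending in [v] has a final part of each length [k]. *)
Lemma walk_table_suffix k (v : 'I_n) : (k <= n)%N -> D k v = 0 -> D n v = 0.
Proof.
move=> kn; rewrite !walk_table_pow // => Dk0.
have Ak0 u : (A ^+ k) u v = 0.
  apply: mple0; rewrite -Dk0; exact: (mp_le_sumT (P := xpredT)).
apply: big1 => u _; have -> : (A ^+ n) u v = (A ^+ (n - k + k)) u v.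
  by rewrite subnK.
by case: (mx_powD A (n - k) k u v) => [//|[w ->]]; rewrite Ak0 mulr0.
Qed.

(** If Karp's formula gives -oo, no node ends a walk of length [n]. *)
Lemma cycle_mean0_nilpotent : is_cycle_mean n D 0 -> A ^+ n = 0.
Proof.
move=> [mean _]; apply/matrixP => u v; rewrite mxE; apply: mple0.
suff <- : D n v = 0.
  by rewrite walk_table_pow //; apply: (mp_le_sumT (P := xpredT)).
have [k kn /mple0] := mean v (ltn_ord v); rewrite /mean_ratio.
case Dn: (D n v) => [x|] //; case Dk: (D k v) => [y|] ratio0.
  by have : true = false := congr1 (fun z => isSome (option_of_maxplus z)) ratio0.
by rewrite -Dn (walk_table_suffix (ltnW kn) Dk).
Qed.

Section Finite.
Variable l : R.
Hypothesis mean : is_cycle_mean n D (Fin l).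

Let nd k v := D k v * Fin (- (k%:R * l)).
Let P (v : nat) := \sum_(k < n) nd k v.

Lemma potential_finite (v : 'I_n) : exists x, P v = Fin x.
Proof.
have n0 : (0 < n)%N by apply: leq_ltn_trans (ltn_ord v).
have : nd 0 v <=t P v.
  exact: (mp_le_sumT (P := xpredT) (fun k : 'I_n => nd k v) (i := Ordinal n0)).
by rewrite /nd D0 mul1r; case: (P v) => [x|] // _; exists x.
Qed.

(** This is the inequality [min_(k < n) (D n v - D k v) / (n - k) <= l]. *)
Lemma last_le_potential (v : 'I_n) : nd n v <=t P v.
Proof.
have [mean_le _] := mean; have [k kn] := mean_le v (ltn_ord v).
have : nd k v <=t P v.
  exact: (mp_le_sumT (P := xpredT) (fun k : 'I_n => nd k v) (i := Ordinal kn)).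
move/(mple_trans _); rewrite /mean_ratio => le_P le_l; apply: le_P; move: le_l.
rewrite /nd; case Dn: (D n v) => [x|]; last by move=> _; apply: mp0le.
case Dk: (D k v) => [y|]; last first.
  by move: (walk_table_suffix (ltnW kn) Dk); rewrite Dn.
have nk0 : 0 < (n - k)%:R :> R by rewrite ltr0n subn_gt0.
rewrite /= mple_FinE ler_pdivrMr // natrB ?(ltnW kn) // => H.
by rewrite !mp_FinM mple_FinE; lra.
Qed.

(** One more arc turns a walk of length [k] into a walk of length [k.+1], and
    length [n] is no better than the shorter lengths. *)
Lemma potential_arc (u v : 'I_n) : P u * A u v <=t Fin l * P v.
Proof.
rewrite mulr_suml; apply: mp_sum_le => k _.
have : D k u * A u v <=t D k.+1 v.
  rewrite DS //.
  exact: (mp_le_sumT (P := xpredT) (fun u : 'I_n => D k u * A u v)).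
move=> /(mple_mulr (Fin (- (k%:R * l)))).
rewrite mulrAC => /mple_trans; apply.
have -> : D k.+1 v * Fin (- (k%:R * l)) = Fin l * nd k.+1 v.
  by rewrite mulrCA mp_FinM; congr (_ * Fin _); rewrite -natr1; ring.
apply: mple_mull; have [kn|nk] := ltnP k.+1 n.
  exact: (mp_le_sumT (P := xpredT) (fun k : 'I_n => nd k v) (i := Ordinal kn)).
have -> : k.+1 = n by apply/eqP; rewrite eqn_leq nk ltn_ord.
exact: last_le_potential.
Qed.

Section Normalized.
Variables (B : 'M[maxplus R]_n) (p : 'I_n -> R).
Hypothesis pE : forall v : 'I_n, P v = Fin (p v).
Hypothesis BE : forall u v, B u v = Fin (p u - l - p v) * A u v.

Lemma normalized_le1 u v : B u v <=t 1.
Proof.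
have := potential_arc u v; rewrite BE !pE.
case: (A u v) => [a|] //.
by rewrite !mp_FinM mple_FinE -[1]/(Fin 0) mple_FinE => H; lra.
Qed.

(** All the prefixes of an optimal walk that attains the cycle mean attain the
    potential of their endpoint, so all its arcs are tight. *)
Lemma tight_walk : exists u v, zero_walk B n u v.
Proof.
have [_ [//|[v0 v0n v0_mean]]] := mean.
pose v := Ordinal v0n; have nd_n : nd n v = P v.
  apply: mple_anti; first exact: last_le_potential.
  apply: mp_sum_le => k _; have := v0_mean k (ltn_ord k); rewrite /mean_ratio /nd.
  rewrite -[v0]/(nat_of_ord v); case: (D n v) => [x|] //.
  case: (D k v) => [y|] //.
  have nk0 : 0 < (n - k)%:R :> R by rewrite ltr0n subn_gt0.
  rewrite /= mple_FinE ler_pdivlMr // natrB ?(ltnW (ltn_ord k)) // => H.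
  by rewrite !mp_FinM mple_FinE; lra.
suff back m : (m <= n)%N -> exists u, zero_walk B m u v /\ nd (n - m) u = P u.
  by have [u [uv _]] := back n (leqnn n); exists u, v.
elim: m => [|m IH] mn.
  by exists v; split; [apply: zero_walk0|rewrite subn0].
have [u [uv nd_u]] := IH (ltnW mn).
set k := (n - m.+1)%N; have kE : (n - m)%N = k.+1 by rewrite /k subnSK.
have kn : (k < n)%N by rewrite /k; lia.
rewrite kE /nd DS // in nd_u.
case: (mp_sum_attained (index_enum 'I_n) xpredT (fun w : 'I_n => D k w * A w u)).
  by move=> S0; rewrite S0 mul0r pE in nd_u.
move=> [w [_ _ wE]]; rewrite wE in nd_u; exists w.
have le_w : nd k w <=t P w.
  exact: (mp_le_sumT (P := xpredT) (fun k : 'I_n => nd k w) (i := Ordinal kn)).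
have le_wu := potential_arc w u.
move: le_w le_wu nd_u; rewrite /nd !pE.
case Dw: (D k w) => [x|] //; case Aw: (A w u) => [y|] //.
rewrite !mp_FinM !mple_FinE => le_w le_wu [nd_u].
move: nd_u; rewrite -natr1 mulrDl mul1r => nd_u.
have xE : x - k%:R * l = p w by lra.
split; last by congr Fin; lra.
apply: (zero_walk_cat normalized_le1 _ uv : zero_walk B (1 + m) w v).
apply/zero_walk1; rewrite BE Aw mp_FinM; congr Fin; lra.
Qed.

End Normalized.

End Finite.
End Karp.

(** * The algorithm *)

Definition graph_phase : prog :=
  PSeq arcs (PSeq transitive_closure (PSeq successors (PSeq init_labels
    (PSeq merge_labels count_labels)))).

Definition rank_program : prog :=
  PSeq walk_table (PSeq cycle_mean
    (PIf (BLeT (TVar 2) TNinfty) (PSetI 8 (IConst 0))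
       (PSeq potentials graph_phase))).

Section GraphPhase.
Variables (R : realType) (s : state R).
Let n := ivar s 0.
Hypothesis n_gt0 : (0 < n)%N.
Hypothesis Z0 : forall u v, iarr s 0 u v = 0%N.
Hypothesis R0 : forall u v, iarr s 1 u v = 0%N.
Hypothesis S0 : forall v, iarr s 3 v 0%N = 0%N.

(** The properties of the closure and of the labels are stated for arbitrary
    relations [T] and [E]; those given by walks are substituted for them later. *)
Lemma graph_phase_spec : exists (link : nat -> nat -> bool) (L S : nat -> nat),
  let cr u v := zero_arc s u v && link v u in
  [/\ [/\ forall u v, (u < n)%N -> (v < n)%N -> zero_arc s u v -> link u v,
          forall u w v, (u < n)%N -> (w < n)%N -> (v < n)%N ->
            link u w -> link w v -> link u v &
          forall T : nat -> nat -> Prop,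
            (forall u v, (u < n)%N -> (v < n)%N -> zero_arc s u v -> T u v) ->
            (forall u w v, (u < n)%N -> (w < n)%N -> (v < n)%N ->
               T u w -> T w v -> T u v) ->
            forall u v, (u < n)%N -> (v < n)%N -> link u v -> T u v],
      forall u, (S u < n)%N,
      forall E : nat -> nat -> Prop, (forall u, E u u) ->
        (forall u v, E u v -> E v u) ->
        (forall u v w, E u v -> E v w -> E u w) ->
        (forall u v u' v',
           (u < n)%N -> (v < n)%N -> (u' < n)%N -> (v' < n)%N ->
           cr u v -> cr u' v' -> E u u' -> E v v') ->
        (forall u v u', (u < n)%N -> (v < n)%N -> (u' < n)%N ->
           E u u' -> cr u v -> exists2 v', (v' < n)%N & cr u' v') ->
        sound_labels n E L /\
        (forall u v, (u < n)%N -> (v < n)%N -> cr u v -> L v = L (S (L u))) &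
      ivar (feval graph_phase s) 8 =
        (\sum_(0 <= v < n) (link v v && (L v == v)))%N].
Proof.
pose s1 := feval arcs s; pose s2 := feval transitive_closure s1.
pose s3 := feval successors s2; pose s4 := feval init_labels s3.
pose s5 := feval merge_labels s4.
have [i1 ia1 _ _] : unchanged arcs s s1 := feval_unchanged _ _.
have [i2 ia2 _ _] : unchanged transitive_closure s1 s2 := feval_unchanged _ _.
have [i3 ia3 _ _] : unchanged successors s2 s3 := feval_unchanged _ _.
have [i4 ia4 _ _] : unchanged init_labels s3 s4 := feval_unchanged _ _.
have [i5 ia5 _ _] : unchanged merge_labels s4 s5 := feval_unchanged _ _.
have n1 : ivar s1 0 = n by apply: i1.
have n2 : ivar s2 0 = n by rewrite -n1; apply: i2.
have n3 : ivar s3 0 = n by rewrite -n2; apply: i3.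
have n4 : ivar s4 0 = n by rewrite -n3; apply: i4.
have n5 : ivar s5 0 = n by rewrite -n4; apply: i5.
have arcsP := arcs_spec Z0 R0; rewrite -/s1 -/n in arcsP.
have [c1 c2 c3] := transitive_closure_spec s1; rewrite -/s2 n1 in c1 c2 c3.
have critE u v : (u < n)%N -> (v < n)%N ->
    crit s2 u v = zero_arc s u v && linked s2 v u.
  move=> un vn; rewrite /crit (ia2 0%N isT) (arcsP u v un vn).1.
  by [].
have crit4 u v : crit s4 u v = crit s2 u v.
  by rewrite /crit (ia4 0%N isT) (ia4 1%N isT) (ia3 0%N isT) (ia3 1%N isT).
have [S1 S2] : (forall u, (succ_of s3 u < n)%N) /\ (forall u v, (u < n)%N ->
    (v < n)%N -> crit s2 u v -> crit s2 u (succ_of s3 u)).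
  rewrite -n2; apply: successors_spec; first by rewrite n2.
  by move=> v; rewrite (ia2 3%N isT) (ia1 3%N isT).
have succ4 u : succ_of s4 u = succ_of s3 u by rewrite /succ_of (ia4 3%N isT).
exists (linked s2), (label s5), (succ_of s3) => cr; split.
- split=> [u v un vn uv|//|T T1 T2].
    by apply: c1; rewrite // /linked (arcsP u v un vn).2.
  by apply: c3 => // u v un vn; rewrite /linked (arcsP u v un vn).2; apply: T1.
- exact: S1.
- move=> E E1 E2 E3 E4 E5.
  have := @merge_labels_spec R s4 E; rewrite n4 -/s5 => -[] //.
  + by move=> v vn; apply: init_labels_spec; rewrite n3.
  + by move=> u; rewrite succ4.
  + by move=> u v un vn; rewrite !crit4 succ4; apply: S2.
  + move=> u v u' v' un vn un' vn'; rewrite !crit4 !critE //; exact: E4.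
  + move=> u v u' un vn un' Euu'; rewrite crit4 critE // => uv.
    have [v' vn' uv'] := E5 u v u' un vn un' Euu' uv.
    by exists v'; rewrite // crit4 critE.
  move=> ok comp; split=> // u v un vn uv.
  by rewrite (comp u v) ?n4 // ?crit4 ?critE // succ4.
- rewrite -[feval graph_phase s]/(feval count_labels s5) count_labels_spec n5.
  apply: eq_bigr => v _; congr (nat_of_bool (_ && _)).
  by rewrite /linked (ia5 1%N isT) (ia4 1%N isT) (ia3 1%N isT).
Qed.

End GraphPhase.

Lemma input_entry (R : realType) n (A : 'M[maxplus R]_n) (u v : 'I_n) :
  tarr (input_state A) 0 u v = A u v.
Proof. by rewrite /= !valK. Qed.

Lemma rank_program_spec (R : realType) n (A : 'M[maxplus R]_n) : (1 <= n)%N ->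
  ivar (feval rank_program (input_state A)) 8 = ultimate_rank A.
Proof.
move=> n1; pose s := input_state A.
pose s1 := feval walk_table s; pose s2 := feval cycle_mean s1.
have [i1 ia1 _ ta1] : unchanged walk_table s s1 := feval_unchanged _ _.
have [i2 ia2 _ ta2] : unchanged cycle_mean s1 s2 := feval_unchanged _ _.
have n_s1 : ivar s1 0 = n by apply: i1.
have n_s2 : ivar s2 0 = n by rewrite -n_s1; apply: i2.
have A_s2 (u v : 'I_n) : tarr s2 0 u v = A u v.
  by rewrite (ta2 0%N isT) (ta1 0%N isT); apply: input_entry.
pose D := tarr s1 1.
have [D0 DS] : is_walk_table n (tarr s 0) D := walk_table_spec s.
have {}D0 (v : 'I_n) : D 0%N v = 1 by apply: D0.
have {}DS k (v : 'I_n) : (k < n)%N -> D k.+1 v = \sum_(u < n) D k u * A u v.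
  move=> kn; rewrite DS // big_mkord; apply: eq_bigr => u _.
  by congr (_ * _); apply: input_entry.
have mean : is_cycle_mean n D (tvar s2 2).
  by have := @cycle_mean_spec R s1; rewrite n_s1; apply.
have -> : feval rank_program s = if tvar s2 2 <=t 0 then set_ivar s2 8 0
    else feval graph_phase (feval potentials s2) by [].
case lamE: (tvar s2 2) => [l|]; last first.
  rewrite lamE in mean; have An := cycle_mean0_nilpotent D0 DS mean.
  by rewrite (ultimate_rank_nilpotent n1 An).
rewrite lamE in mean; rewrite (_ : _ <=t 0 = false) //.
pose s3 := feval potentials s2.
have [i3 ia3 t3 ta3] : unchanged potentials s2 s3 := feval_unchanged _ _.
have n_s3 : ivar s3 0 = n by rewrite -n_s2; apply: i3.
have PE v : (v < n)%N -> tarr s3 2 v 0%N =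
    \sum_(k < n) D k v * Fin (- (k%:R * l)).
  move=> vn; rewrite (potentials_spec lamE) ?n_s2 //; last first.
    by move=> w; rewrite (ta2 2%N isT) (ta1 2%N isT).
  rewrite big_mkord; apply: eq_bigr => k _.
  by rewrite maxplus_subE (ta2 1%N isT).
have /choice[p pE] : forall v : 'I_n, exists x, tarr s3 2 v 0%N = Fin x.
  move=> v; have [x xE] := potential_finite D0 l v.
  by exists x; rewrite PE.
pose B : 'M[maxplus R]_n := \matrix_(u, v) (Fin (p u - l - p v) * A u v).
have BE u v : B u v = Fin (p u - l - p v) * A u v by rewrite mxE.
have pE' (v : 'I_n) : \sum_(k < n) D k v * Fin (- (k%:R * l)) = Fin (p v).
  by rewrite -PE ?pE.
have B_le1 := normalized_le1 D0 DS mean pE' BE.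
have AE u v : A u v = Fin (l - p u + p v) * B u v.
  rewrite BE mulrA mp_FinM (_ : Fin _ = 1) ?mul1r //; congr Fin; ring.
have zeroE (u v : 'I_n) : zero_arc s3 u v <-> B u v = 1.
  rewrite /zero_arc (t3 2%N isT) (ta3 0%N isT) A_s2 lamE !pE.
  have := B_le1 u v; rewrite BE; case: (A u v) => [a|] //.
  rewrite !mp_FinM -[1]/(Fin 0) !mple_FinE => le0; split=> [H|[H]].
    by congr Fin; lra.
  by lra.
have [||||link [L [S [[lk1 lk2 lk3] S_lt labP out]]]] := @graph_phase_spec R s3.
- by rewrite n_s3.
- by move=> u v; rewrite (ia3 0%N isT) (ia2 0%N isT) (ia1 0%N isT).
- by move=> u v; rewrite (ia3 1%N isT) (ia2 1%N isT) (ia1 1%N isT).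
- by move=> v; rewrite (ia3 3%N isT) (ia2 3%N isT) (ia1 3%N isT).
rewrite {}out; rewrite !n_s3 in lk1 lk2 lk3 S_lt labP *.
pose o x : 'I_n := insubd (Ordinal n1) x.
have oK x : (x < n)%N -> val (o x) = x by move=> xn; rewrite val_insubd xn.
have valo (u : 'I_n) : o u = u by apply: valKd.
have linkE (u v : 'I_n) : link u v <-> exists2 b, (0 < b)%N & zero_walk B b u v.
  split=> [uv|[b b0 uv]].
    rewrite -(valo u) -(valo v).
    pose T x y := exists2 b, (0 < b)%N & zero_walk B b (o x) (o y).
    apply: (lk3 T) uv => // [x y xn yn|x w y xn wn yn [b b0 xw] [b' _ wy]].
      rewrite -{1}(oK x xn) -{1}(oK y yn) => /zeroE xy.
      by exists 1%N => //; apply/zero_walk1.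
    exists (b + b')%N; first by rewrite addn_gt0 b0.
    exact: (zero_walk_cat B_le1 xw wy).
  elim: b b0 u uv => // b IH _ u; rewrite -add1n.
  case/(zero_walk_split B_le1) => w [/zero_walk1 uw wv].
  have {}uw : link u w by apply: lk1 => //; apply/zeroE.
  case: b IH wv => [|b] IH wv.
    by have [<-] : w = v by apply: zero_walk0_eq wv.
  by apply: (lk2 u w v) => //; apply: IH.
have crE (u v : 'I_n) : zero_arc s3 u v && link v u <-> critical_arc B u v.
  split=> [/andP[/zeroE uv /linkE[b _ vu]]|[uv [[|b] vu]]].
  - by split=> //; exists b.
  - rewrite (zero_walk0_eq vu) in uv *; move/zeroE: uv => uv.
    by rewrite uv /=; apply: lk1.
  - by apply/andP; split; [apply/zeroE|apply/linkE; exists b.+1].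
have [||||| lab_ok lab_arc] := labP (fun x y => same_class B (o x) (o y)).
- by move=> u; apply: same_class_refl.
- by move=> u v; apply: same_class_sym.
- by move=> u v w; apply: same_class_trans.
- move=> u v u' v' un vn un' vn'.
  rewrite -{1}(oK u un) -{1}(oK v vn) -{1}(oK u' un') -{1}(oK v' vn').
  rewrite -{1 2}(oK u un) -{1 2}(oK v vn) -{1 2}(oK u' un') -{1 2}(oK v' vn').
  by rewrite !valo => /crE uv /crE uv'; apply: (same_class_succ B_le1 uv uv').
- move=> u v u' un vn un'; rewrite -(oK u un) -(oK v vn) -(oK u' un') !valo.
  move=> uu' /crE/(critical_arcl B_le1) crit_u.
  have [v' uv'] := critical_succ B_le1 (same_class_critical B_le1 crit_u uu').
  by exists v' => //; apply/crE.
have crit_ex : exists u, critical B u.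
  have [u [v uv]] := tight_walk D0 DS mean pE' BE.
  by have [w [b [b0 ww]]] := zero_walk_cycle B_le1 (leqnn n) uv; exists w, b.
pose F := [set v : 'I_n | link v v && (L v == v)].
rewrite (@ultimate_rank_labels _ _ A B l p (fun u => o (L u))
           (fun u => o (S u)) F).
- rewrite big_mkord -sum1_card [RHS]big_mkcond /=; apply: eq_bigr => v _.
  by rewrite inE; case: (_ && _).
- exact: B_le1.
- exact: AE.
- move=> u; have [Lun LLu _] := lab_ok u (ltn_ord u).
  by rewrite oK // LLu.
- by move=> u; have [_ _] := lab_ok u (ltn_ord u); rewrite valo.
- move=> u v /crE uv; have [Lun _ _] := lab_ok u (ltn_ord u).
  by rewrite (oK (L u)) // oK // (lab_arc u v (ltn_ord u) (ltn_ord v) uv).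
- move=> v; rewrite inE; have [Lvn _ _] := lab_ok v (ltn_ord v).
  split=> [/andP[/linkE vv /eqP Lv]|[vv Lv]]; first by rewrite Lv valo.
  by apply/andP; split; [apply/linkE|rewrite -{2}Lv oK].
- exact: crit_ex.
Qed.

Theorem corollary5p4 (R : realType) :
  exists (P : cmd) (C : nat),
    forall (n : nat) (A : 'M[maxplus R]_n), (1 <= n)%N ->
      exists (s : state R) (t : nat),
        [/\ exec P (input_state A) s t,
            (t <= C * n ^ 3)%N
          & output s = ultimate_rank A].
Proof.
(* the result is moved to the output variable by one more assignment *)
exists (CSeq (compile rank_program) (CSetI 0 (IVar 8))).
exists (weight rank_program + 2)%N => n A n1.
have [| | |t ex_t t_le] := @exec_feval R rank_program (input_state A).
- by [].
- by [].
- exact: n1.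
exists (set_ivar (feval rank_program (input_state A)) 0
  (ivar (feval rank_program (input_state A)) 8)), (t + 2)%N; split.
- exact: ExecSeq ex_t (ExecSetI _ 0 (IVar 8)).
- rewrite mulnDl; apply: leq_add; first exact: t_le.
  by rewrite leq_pmulr // expn_gt0 n1.
- by rewrite /output -(rank_program_spec A n1).
Qed.
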